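(* Let $h$ and $f$ be homogeneous polynomials in $n$ variables, with $h$ reduced of degree $n$; put $D=h^{-1}(0)$ and $D_t=h^{-1}(t)$ for $t\neq 0$ ($D$ is not assumed to be a free divisor). If $f_{|D}:D\to\mathbb{C}$ has a right-left stable singularity at $0$, then for $t\ne 0$ the function $f_{|D_t}$ is a Morse function, or non-singular (i.e. without critical points).
   Context: $f_{|D_t}$ is called a Morse function if all its critical points are isolated and non-degenerate and all its critical values are distinct. If $(X,x)$ is a germ of complex variety, an analytic map-germ $f:(X,x)\to(\mathbb{C}^p,0)$ is right-left stable if every germ of deformation $F:(X\times\mathbb{C},(x,0))\to(\mathbb{C}^p\times\mathbb{C},(0,0))$ can be trivialised by suitable parametrised families of bianalytic diffeomorphisms of source and target. This is equivalent to infinitesimal right-left stability; for $p=1$ and $(X,0)=(D,0)\subset(\mathbb{C}^n,0)$ it says that the image in $\mathcal{O}_{D,0}$ of $df(\mathrm{Der}(-\log D))+\mathbb{C}\{f\}$ is all of $\mathcal{O}_{D,0}$, where $\mathrm{Der}(-\log D)$ is the module of germs of vector fields $\chi$ with $\chi\cdot h\in(h)$. *)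

(* Defs.v *)
From HB Require Import structures.
From mathcomp Require Import all_boot all_order all_algebra.
From mathcomp Require Export mpoly complex.
From mathcomp Require Import boolp classical_sets reals topology normedtype.

Set Implicit Arguments.
Unset Strict Implicit.
Unset Printing Implicit Defensive.
Import Order.TTheory GRing.Theory Num.Theory.
Import numFieldNormedType.Exports.
Local Open Scope classical_set_scope.
Local Open Scope ring_scope.

(** Points of [K^n] are row vectors [x : 'rV[K]_n], and [p.@[x 0]] is the value
    at [x] of the polynomial [p]. *)

(** ** Analytic maps and right-left stability *)

(** [g] is, near [a], the sum of a power series [\sum_m c_m (z - a)^m] which
    converges absolutely at the polyradius [(rho, ..., rho)].  The sums are
    ordered by total degree: ['X_{1..n < N}] is the finite type of the
    multi-indices of total degree less than [N]. *)
Definition analytic_at (K : numFieldType) (n : nat) (g : 'rV[K]_n -> K)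
    (a : 'rV[K]_n) : Prop :=
  exists (c : 'X_{1..n} -> K) (rho M : K),
  [/\ 0 < rho,
      forall N : nat,
        \sum_(m : 'X_{1..n < N}) `|c m| * rho ^+ mdeg m <= M
    & forall x : 'rV[K]_n, (forall i, `|x 0 i| < rho) ->
        (fun N : nat => \sum_(m : 'X_{1..n < N}) c m * \prod_(i < n) x 0 i ^+ m i)
          @ \oo --> g (a + x)].

Definition analytic_map_at (K : numFieldType) (n p : nat)
    (g : 'rV[K]_n -> 'rV[K]_p) (a : 'rV[K]_n) : Prop :=
  forall j : 'I_p, analytic_at (fun x => g x 0 j) a.

(** A point [(x, s)] of [K^n * K] is encoded as [row_mx x s : 'rV[K]_(n + 1)];
    a map [(x, s) |-> (phi_s(x), s)] over the parameter line is encoded by its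
    first component [phi]. *)
Definition with_param (K : numFieldType) (n p : nat)
    (phi : 'rV[K]_(n + 1) -> 'rV[K]_p) (z : 'rV[K]_(n + 1)) : 'rV[K]_(p + 1) :=
  row_mx (phi z) (rsubmx z).

(** Germs on a subvariety [X] are restrictions of germs of analytic maps of the
    ambient space, and all identities between them are required on [X] only.

    [(x, s) |-> (phi_s(x), s)] is a germ at [(a, 0)] of bianalytic
    diffeomorphisms of [X * K], with [phi_0 = id]; [phi'] gives its inverse. *)
Definition bianalytic_family (K : numFieldType) (n : nat) (X : set 'rV[K]_n)
    (a : 'rV[K]_n) (phi : 'rV[K]_(n + 1) -> 'rV[K]_n) : Prop :=
  exists phi' : 'rV[K]_(n + 1) -> 'rV[K]_n,
  [/\ analytic_map_at phi (row_mx a 0),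
      analytic_map_at phi' (row_mx a 0),
      \forall x \near a, X x -> phi (row_mx x 0) = x
    & \forall z \near (row_mx a 0 : 'rV[K]_(n + 1)), X (lsubmx z) ->
        [/\ X (phi z), X (phi' z),
            phi' (with_param phi z) = lsubmx z
          & phi (with_param phi' z) = lsubmx z]].

(** [(x, s) |-> (F(x, s), s)] is a germ of one-parameter deformation of the
    germ of [f] at the point [a] of [X]. *)
Definition deformation (K : numFieldType) (n p : nat) (X : set 'rV[K]_n)
    (a : 'rV[K]_n) (f : 'rV[K]_n -> 'rV[K]_p)
    (F : 'rV[K]_(n + 1) -> 'rV[K]_p) : Prop :=
  analytic_map_at F (row_mx a 0) /\
  \forall x \near a, X x -> F (row_mx x 0) = f x.

(** [psi_s \o F_s \o phi_s = f] as germs at [(a, 0)]. *)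
Definition trivial_deformation (K : numFieldType) (n p : nat)
    (X : set 'rV[K]_n) (a : 'rV[K]_n) (f : 'rV[K]_n -> 'rV[K]_p)
    (F : 'rV[K]_(n + 1) -> 'rV[K]_p) : Prop :=
  exists (phi : 'rV[K]_(n + 1) -> 'rV[K]_n) (psi : 'rV[K]_(p + 1) -> 'rV[K]_p),
  [/\ bianalytic_family X a phi,
      bianalytic_family setT (f a) psi
    & \forall z \near (row_mx a 0 : 'rV[K]_(n + 1)), X (lsubmx z) ->
        psi (with_param F (with_param phi z)) = f (lsubmx z)].

Definition rl_stable (K : numFieldType) (n p : nat) (X : set 'rV[K]_n)
    (a : 'rV[K]_n) (f : 'rV[K]_n -> 'rV[K]_p) : Prop :=
  forall F : 'rV[K]_(n + 1) -> 'rV[K]_p,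
    deformation X a f F -> trivial_deformation X a f F.

(** ** Hypersurfaces and Morse functions *)

Definition mpoly_fun (K : numFieldType) (n : nat) (f : {mpoly K[n]})
    (x : 'rV[K]_n) : 'rV[K]_1 := const_mx f.@[x 0].

Definition mdvd (K : numFieldType) (n : nat) (h q : {mpoly K[n]}) : Prop :=
  exists u : {mpoly K[n]}, q = u * h.

(** The ring [K[x_1, ..., x_n] / (h)] has no nonzero nilpotent element. *)
Definition reduced (K : numFieldType) (n : nat) (h : {mpoly K[n]}) : Prop :=
  forall (q : {mpoly K[n]}) (k : nat), mdvd h (q ^+ k) -> mdvd h q.

Definition fiber (K : numFieldType) (n : nat) (h : {mpoly K[n]}) (t : K) :
    set 'rV[K]_n := [set x | h.@[x 0] = t].

(** The differential of [p] at [x], applied to [v]. *)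
Definition dmpoly (K : numFieldType) (n : nat) (p : {mpoly K[n]})
    (x v : 'rV[K]_n) : K := \sum_(i < n) v 0 i * (p^`M(i)).@[x 0].

(** The derivative of [p] along the vector field [\sum_i W_i d/dx_i]. *)
Definition lie (K : numFieldType) (n : nat) (W : 'I_n -> {mpoly K[n]})
    (p : {mpoly K[n]}) : {mpoly K[n]} := \sum_(i < n) W i * p^`M(i).

(** For [h] homogeneous of positive degree and [t != 0], Euler's relation shows
    that [dh] does not vanish on [fiber h t], which is therefore a manifold with
    tangent space [ker dh_x] at [x]. *)
Definition tangent (K : numFieldType) (n : nat) (h : {mpoly K[n]})
    (x : 'rV[K]_n) : set 'rV[K]_n := [set v | dmpoly h x v = 0].

Definition tangent_field (K : numFieldType) (n : nat) (h : {mpoly K[n]})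
    (t : K) (W : 'I_n -> {mpoly K[n]}) : Prop :=
  forall x, fiber h t x -> tangent h x (\row_i (W i).@[x 0]).

Definition critical (K : numFieldType) (n : nat) (f h : {mpoly K[n]}) (t : K) :
    set 'rV[K]_n :=
  [set x | fiber h t x /\ forall v, tangent h x v -> dmpoly f x v = 0].

(** The Hessian at a critical point [x] of a function [f] on a manifold is the
    bilinear form [(v, w) |-> v (W f)] on the tangent space at [x], where [W] is
    any tangent vector field with [W(x) = w].  Polynomial fields suffice here:
    the values at [x] of [(d_i h) d_j - (d_j h) d_i] span [ker dh_x]. *)
Definition nondegenerate (K : numFieldType) (n : nat) (f h : {mpoly K[n]})
    (t : K) (x : 'rV[K]_n) : Prop :=
  forall v, tangent h x v -> v != 0 ->
    exists W : 'I_n -> {mpoly K[n]},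
      tangent_field h t W /\ dmpoly (lie W f) x v != 0.

Definition morse (K : numFieldType) (n : nat) (f h : {mpoly K[n]}) (t : K) :
    Prop :=
  [/\ forall x, critical f h t x -> isolated (critical f h t) x,
      forall x, critical f h t x -> nondegenerate f h t x
    & forall x y, critical f h t x -> critical f h t y ->
        f.@[x 0] = f.@[y 0] -> x = y].

(* Main.v *)
(** Since all data are homogeneous, only first-order terms of right-left
    stability matter.  Trivialise the deformation [f + s * x_i] by [phi, psi],
    evaluate at [(l x, l ^ k)] with [x] in [D] and [k] large, and compare the
    two lowest-order terms in [l] beyond the zeroth-order identity: with
    [b + L x] the 1-jet of [d phi / d s] at [s = 0], the constant field [b] and
    the linear field [L x] are both tangent to [D] along [D], and there
    - [df (b) + x_i = 0] if [f] has degree 2,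
    - [df (L x) + x_i + a f (x) = 0] if [f] has degree 1,
    - [x_i = 0] in the other degrees.
    As [h] is reduced, a form of degree less than [n] that vanishes on [D] is
    zero and one of degree [n] is a multiple of [h], so these identities hold
    identically when [n >= 2].  Degrees other than 1 and 2 are then excluded.
    In degree 2 the constant fields kill [h], so a critical point of [f] on
    [D_t] has all its coordinates zero, and there is none.  In degree 1,
    subtracting a multiple of the Euler field from [L x] gives fields [W_i] with
    [W_i h = 0] and [W_i f = - (x_i + c_i f)]: a critical point satisfies
    [x = - f (x) c], and the Hessian pairs a tangent vector [v] with [W_i] to
    [- v_i]. *)
From HB Require Import structures.
Require Import Defs.
From mathcomp Require Import all_boot all_order all_algebra.
From mathcomp Require Import boolp classical_sets reals topology normedtype.
From mathcomp Require Import separable ssrcomplements ring.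

Set Implicit Arguments.
Unset Strict Implicit.
Unset Printing Implicit Defensive.
Import Order.TTheory GRing.Theory Num.Theory.
Import numFieldNormedType.Exports.
Local Open Scope classical_set_scope.
Local Open Scope ring_scope.

(** * Polynomials vanishing on a reduced homogeneous hypersurface *)

(** Induction along the ring operations instead of monomial by monomial. It suits statements whose
    product step is a form of the Leibniz rule, such as [deriv_line_poly] and [isO_taylor]. *)
Lemma mpoly_ring_ind (n : nat) (R : comNzRingType) (P : {mpoly R[n]} -> Prop) :
  (forall c, P c%:MP) -> (forall i, P 'X_i) ->
  (forall p q, P p -> P q -> P (p + q)) ->
  (forall p q, P p -> P q -> P (p * q)) -> forall p, P p.
Proof.
move=> PC PX PD PM; elim/mpolyind => [|c m p _ _ Pp]; first by rewrite -mpolyC0.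
apply: PD => //; rewrite -mul_mpolyC; apply: (PM) => //.
rewrite mpolyXE_id; apply: (big_ind P _ PM) => [|i _]; first by rewrite -mpolyC1.
elim: (m i) => [|k IH]; first by rewrite expr0 -mpolyC1.
by rewrite exprS; apply: PM.
Qed.

Lemma mpoly_rmorph_eq (n : nat) (R S : comNzRingType)
    (f g : {rmorphism {mpoly R[n]} -> S}) :
  (forall c, f c%:MP = g c%:MP) -> (forall i, f 'X_i = g 'X_i) -> f =1 g.
Proof.
move=> fgC fgX; elim/mpoly_ring_ind => // p q Ep Eq.
  by rewrite !rmorphD Ep Eq.
by rewrite !rmorphM Ep Eq.
Qed.

(** * Homogeneous polynomials and Euler's relation *)

Lemma dhomog_mderiv (n d : nat) (R : comNzRingType) (p : {mpoly R[n]}) i :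
  p \is d.-homog -> p^`M(i) \is d.-1.-homog.
Proof.
move=> hp; apply/dhomogP => m; rewrite mcoeff_msupp mcoeff_deriv => nz.
have: p@_(m + U_(i)) != 0 by apply: contraNneq nz => ->; rewrite mul0rn.
by rewrite -mcoeff_msupp => /(dhomog_mf hp) /=; rewrite mdegD mdeg1 addn1 => <-.
Qed.

Lemma dhomog0_mderiv (n : nat) (R : comNzRingType) (p : {mpoly R[n]}) i :
  p \is 0.-homog -> p^`M(i) = 0.
Proof.
move=> hp; apply/mpolyP => m; rewrite mcoeff_deriv mcoeff0.
by rewrite (dhomog_nemf_coeff hp) ?mul0rn //= mdegD mdeg1 addn1.
Qed.

Lemma dhomog_meval_scale (n d : nat) (R : comNzRingType) (p : {mpoly R[n]})
    (l : R) (x : 'I_n -> R) :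
  p \is d.-homog -> p.@[fun i => l * x i] = l ^+ d * p.@[x].
Proof.
move=> hp; rewrite !mevalE mulr_sumr; apply: eq_big_seq => m mp.
have <- : mdeg m = d by apply: (dhomog_mf hp).
rewrite mulrCA mdegE -prodrXr -big_split /=; congr (_ * _).
by apply: eq_bigr => i _; rewrite exprMn.
Qed.

(** Each monomial is an eigenvector of ['X_i] times the [i]-th derivative, with eigenvalue its
    exponent [m i]; these exponents add up to [mdeg m = d]. *)
Lemma euler (n d : nat) (R : comNzRingType) (p : {mpoly R[n]}) (x : 'I_n -> R) :
  p \is d.-homog -> \sum_(i < n) x i * (p^`M(i)).@[x] = d%:R * p.@[x].
Proof.
move=> hp; have XE i m : 'X_i * ('X_[m])^`M(i) = (m i)%:R *: 'X_[m] :> {mpoly R[n]}.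
  rewrite mderivX -scalerAr; case: (posnP (m i)) => [->|mi].
    by rewrite !scale0r.
  by rewrite -mpolyXD addmC submK // lep1mP -lt0n.
suff -> : d%:R * p.@[x] = (\sum_(i < n) 'X_i * p^`M(i)).@[x].
  by rewrite raddf_sum; apply: eq_bigr => i _ /=; rewrite mevalM mevalXU.
have dE i : 'X_i * p^`M(i) = \sum_(m <- msupp p) p@_m *: ((m i)%:R *: 'X_[m]).
  rewrite {1}[p]mpolyE raddf_sum /= mulr_sumr; apply: eq_bigr => m _.
  by rewrite mderivZ -scalerAr XE.
rewrite -mevalZ; congr meval; rewrite {1}[p]mpolyE scaler_sumr.
under [RHS]eq_bigr do rewrite dE.
rewrite exchange_big; apply: eq_big_seq => m mp /=.
have <- : mdeg m = d by apply: (dhomog_mf hp).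
by rewrite -scaler_sumr -scaler_suml -natr_sum mdegE scalerA mulrC -scalerA.
Qed.

(** [p] along the line [u + s e], as a polynomial in [s]. *)
Definition line_poly (n : nat) (K B : comNzRingType) (iota : {rmorphism K -> B})
    (u e : 'I_n -> B) : {mpoly K[n]} -> {poly B} :=
  mmap (polyC \o iota) (fun i => (u i)%:P + (e i)%:P * 'X).

HB.instance Definition _ n K B iota u e :=
  GRing.RMorphism.copy (@line_poly n K B iota u e) (line_poly iota u e).

Lemma line_polyC n K B iota u e c : @line_poly n K B iota u e c%:MP = (iota c)%:P.
Proof. exact: mmapC. Qed.

Lemma line_polyX n K B iota u e i :
  @line_poly n K B iota u e 'X_i = (u i)%:P + (e i)%:P * 'X.
Proof. by rewrite /line_poly mmapX mmap1U. Qed.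

Lemma horner_line_poly (n : nat) (K : comNzRingType) (u e : 'I_n -> K) p s :
  (line_poly idfun u e p).[s] = p.@[fun i => u i + e i * s].
Proof.
rewrite -[LHS]/((horner_eval s \o line_poly idfun u e) p).
apply: mpoly_rmorph_eq => [c|i] /=; rewrite /horner_eval.
  by rewrite line_polyC hornerC mevalC.
by rewrite line_polyX mevalXU !hornerE.
Qed.

(** Evaluating the coefficients at [y] turns the line through the generic point ['X_i] into the line
    through [y]. An identity proved once over [{mpoly K[n]}] thus holds on every line of direction
    [e]. *)
Lemma map_line_poly (n : nat) (K : comNzRingType) (y e : 'I_n -> K) p :
  map_poly (meval y)
    (line_poly (@mpolyC n K) (fun i => 'X_i) (fun i => (e i)%:MP) p) =
  line_poly idfun y e p.
Proof.
rewrite -[LHS]/((map_poly (meval y) \o line_poly (@mpolyC n K)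
  (fun i => 'X_i) (fun i => (e i)%:MP)) p).
apply: mpoly_rmorph_eq => [c|i] /=.
  by rewrite !line_polyC map_polyC /= mevalC.
rewrite !line_polyX rmorphD rmorphM /= !map_polyC map_polyX /=.
by rewrite mevalXU mevalC.
Qed.

(** This is the chain rule along a line. *)
Lemma deriv_line_poly (n : nat) (K : comNzRingType) (u e : 'I_n -> K) p :
  (line_poly idfun u e p)^`() =
  \sum_(i < n) (e i)%:P * line_poly idfun u e p^`M(i).
Proof.
elim/mpoly_ring_ind: p => [c|j|p q Ep Eq|p q Ep Eq].
- rewrite line_polyC derivC big1 // => i _.
  by rewrite mderivC rmorph0 mulr0.
- rewrite line_polyX derivD derivC add0r derivM derivC mul0r add0r derivX mulr1.
  rewrite (bigD1 j) //= mderivX mnm1E eqxx -{1}[U_(j)%MM]add0m addmK mpolyX0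
    scale1r rmorph1 mulr1.
  rewrite big1 ?addr0 // => i ij; rewrite mderivX mnm1E.
  by rewrite eq_sym (negbTE ij) scale0r rmorph0 mulr0.
- rewrite !rmorphD derivD Ep Eq -big_split; apply: eq_bigr => i _ /=.
  by rewrite mderivD rmorphD mulrDr.
- rewrite rmorphM derivM Ep Eq mulr_suml mulr_sumr -big_split.
  apply: eq_bigr => i _ /=; rewrite mderivM rmorphD !rmorphM mulrDr /=.
  by congr (_ + _); [rewrite mulrA | rewrite mulrCA].
Qed.

Lemma size_coef_mul (B : comNzRingType) (p q : {poly B}) (a b : nat) :
  (size p <= a.+1)%N -> (size q <= b.+1)%N ->
  (size (p * q)%R <= (a + b).+1)%N /\ (p * q)`_(a + b) = p`_a * q`_b.
Proof.
move=> sp sq; split.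
  apply: leq_trans (size_polyMleq _ _) _.
  by rewrite -subn1 leq_subLR add1n -addnS -addSn leq_add.
rewrite coefM (bigD1 (inord a : 'I_(a + b).+1)) //= inordK ?ltnS ?leq_addr //.
rewrite addKn big1 ?addr0 // => i; rewrite -val_eqE /= inordK ?ltnS ?leq_addr //.
rewrite neq_ltn => /orP[ia|ai]; last first.
  by rewrite (nth_default _ (leq_trans sp ai)) mul0r.
rewrite [q`_ _]nth_default ?mulr0 //; apply: leq_trans sq _.
by rewrite ltn_subRL ltn_add2r.
Qed.

(** In top degree only the terms [e i * 'X] contribute, so the coefficient is [p] evaluated at the
    direction [e]. The size is only bounded, since this coefficient may vanish; bound and
    coefficient together are multiplicative, which reduces the claim to powers of single
    variables. *)
Lemma line_poly_homog (n d : nat) (K B : comNzRingType)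
    (iota : {rmorphism K -> B}) (u e : 'I_n -> B) (p : {mpoly K[n]}) :
  p \is d.-homog ->
  (size (line_poly iota u e p) <= d.+1)%N /\
  (line_poly iota u e p)`_d = mmap iota e p.
Proof.
move=> hp.
pose Q (q : {poly B}) a c := (size q <= a.+1)%N /\ q`_a = c.
have QM q1 q2 q3 a b c : Q q1 a q2 -> Q b c q3 -> Q (q1 * b) (a + c)%N (q2 * q3).
  move=> [s1 <-] [s2 <-]; exact: size_coef_mul.
have Q1 : Q 1 0%N 1 by rewrite /Q size_poly1 coefC.
pose L i := (u i)%:P + (e i)%:P * 'X.
have QL i k : Q (L i ^+ k) k (e i ^+ k).
  elim: k => [|k IH]; first by rewrite !expr0.
  rewrite !exprS -add1n; apply: (QM _ _ _ _ _ _ _ IH); split.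
    rewrite /L addrC size_MXaddC; case: ifP => // _.
    by rewrite ltnS (leq_trans (size_polyC_leq1 _)).
  by rewrite /L coefD coefC add0r coefMX coefC.
have QX m : Q (mmap1 L m) (mdeg m) (mmap1 e m).
  rewrite mdegE /mmap1; elim/big_rec3: _ => // i q1 a q2 _; apply: QM.
  exact: QL.
have QS : Q (mmap (polyC \o iota) L p) d (mmap iota e p).
  rewrite /mmap !big_seq; apply: (big_rec2 (fun q c => Q q d c)).
    by rewrite /Q size_poly0 coef0.
  move=> m q c mp [sc <-]; rewrite -(dhomog_mf hp mp).
  have [sm <-] := QX m; split; last by rewrite coefD coefCM.
  apply: leq_trans (size_polyD _ _) _; rewrite geq_max.
  rewrite [X in _ && (_ <= X.+1)%N](dhomog_mf hp mp) sc andbT mul_polyC.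
  exact: leq_trans (size_scale_leq _ _) sm.
exact: QS.
Qed.

(** * Polynomials are determined by their values *)

(** In characteristic zero the natural numbers below [size q] are distinct roots, one more than the
    degree allows. *)
Lemma poly_horner_eq0 (K : numDomainType) (q : {poly K}) :
  (forall s, q.[s] = 0) -> q = 0.
Proof.
move=> q0; pose rs := [seq i%:R : K | i <- iota 0 (size q)].
apply: (@roots_geq_poly_eq0 _ _ rs); last by rewrite size_map size_iota.
  by apply/allP => s _; rewrite rootE q0.
by rewrite map_inj_uniq ?iota_uniq // => i j /eqP; rewrite eqr_nat => /eqP.
Qed.

(** Induction on the degree of the monomial whose coefficient is examined. The partial derivatives
    of [p] vanish everywhere too, by restriction to lines in coordinate directions, and the
    coefficient of [p] at [m] is, up to the nonzero integer factor [m i], a coefficient of such a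
    derivative at a monomial of lower degree. *)
Lemma mpoly_meval_eq0 (n : nat) (K : numDomainType) (p : {mpoly K[n]}) :
  (forall x : 'I_n -> K, p.@[x] = 0) -> p = 0.
Proof.
move=> p0; apply/mpolyP => m; rewrite mcoeff0.
elim: {m}(mdeg m) {-2}m p p0 (erefl (mdeg m)) => [|k IH] m p p0 mk.
  have /eqP -> : m == 0%MM by rewrite -mdeg_eq0 mk.
  rewrite -[RHS](p0 (fun => 0)); apply: (@mpoly_rmorph_eq n K K (mcoeff 0)).
    by move=> c; rewrite /= mcoeffC eqxx mulr1 mevalC.
  by move=> i; rewrite /= mcoeffX mnm1_eq0 mevalXU.
have [i mi] : exists i, m i != 0%N.
  case: (pickP (fun i => m i != 0%N)) => [i mi|m0]; first by exists i.
  suff m00 : m = 0%MM by rewrite m00 mdeg0 in mk.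
  by apply/mnmP => i; rewrite mnm0E; apply/eqP/negbFE/m0.
have dp0 x : p^`M(i).@[x] = 0.
  pose e j : K := (j == i)%:R.
  have : (line_poly idfun x e p)^`() = 0.
    rewrite (@poly_horner_eq0 _ (line_poly idfun x e p)) ?deriv0 // => s.
    by rewrite horner_line_poly.
  move=> /(congr1 (horner^~ 0)); rewrite deriv_line_poly horner_sum horner0.
  rewrite (bigD1 i) //= big1 ?addr0 => [|j /negbTE ji].
    rewrite /e eqxx mul1r horner_line_poly => <-; apply: meval_eq => j.
    by rewrite mulr0 addr0.
  by rewrite /e ji mul0r horner0.
have := IH (m - U_(i))%MM _ dp0; rewrite mcoeff_deriv submK ?lep1mP //.
have mk' : mdeg (m - U_(i))%MM = k.
  have := mk; rewrite -{1}(@submK _ U_(i)%MM m) ?lep1mP //.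
  by rewrite mdegD mdeg1 addn1 => -[].
by move/(_ mk')/eqP; rewrite mulrn_eq0 /= => /eqP.
Qed.

Lemma mpoly_neq0_meval (n : nat) (K : numDomainType) (p : {mpoly K[n]}) :
  p != 0 -> exists x : 'I_n -> K, p.@[x] != 0.
Proof.
move=> p0; apply: contrapT => /forallNP px; case/negP: p0.
by apply/eqP/mpoly_meval_eq0 => x; apply/eqP/negbNE/negP/px.
Qed.

(** * Reducedness and separability along lines *)

(** If a ring [A] is reduced, so is [A[s]]: the top coefficient of [w ^+ 2] is the square of the top
    coefficient of [w], which is therefore divisible by [h]. Removing the top term of [w] lowers its
    size. *)
Lemma reduced_polyC (n : nat) (K : numFieldType) (h : {mpoly K[n]})
    (w v : {poly {mpoly K[n]}}) :
  reduced h -> w ^+ 2 = v * h%:P -> exists v', w = v' * h%:P.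
Proof.
move=> hred; elim: {w}(size w) {-2}w (leqnn (size w)) v => [|k IH] w.
  by rewrite size_poly_leq0 => /eqP -> v _; exists 0; rewrite mul0r.
rewrite leq_eqVlt => /orP[/eqP sw v wv|]; last by rewrite ltnS => /IH.
have [u lcu] : mdvd h w`_k.
  apply: (hred _ 2%N); exists v`_(k + k)%N.
  have [_ E] := size_coef_mul (eq_leq sw) (eq_leq sw).
  by rewrite expr2 -E -expr2 wv coefMC.
pose w1 := w - w`_k *: 'X^k.
have sw1 : (size w1 <= k)%N.
  apply/leq_sizeP => j; rewrite leq_eqVlt => /orP[/eqP <-|kj].
    by rewrite coefB coefZ coefXn eqxx mulr1 subrr.
  rewrite coefB coefZ coefXn gtn_eqF // mulr0 subr0.
  by rewrite nth_default // sw.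
have EL : u *: 'X^k * h%:P = w`_k *: 'X^k.
  by rewrite -scalerAl mulrC mul_polyC scalerA lcu.
(* The cofactor comes from [(w - L) ^+ 2 = w ^+ 2 - L * (w *+ 2 - L)], where the removed term [L]
   equals [u *: 'X^k * h%:P]. *)
have [] := IH _ sw1 (v - u *: 'X^k * (w *+ 2 - w`_k *: 'X^k)).
  rewrite mulrBl -wv mulrAC EL /w1; move: (_ *: _) => L.
  by rewrite sqrrB mulrBr mulrnAr (mulrC L) opprB addrA addrAC -expr2.
by move=> v1 Ew; exists (v1 + u *: 'X^k); rewrite mulrDl -Ew EL subrK.
Qed.

(** The automorphism [x |-> x + s e, s |-> s] of [K[x][s]]; it carries the
    constant [h] to [h (x + s e)]. *)
Definition shift_poly (n : nat) (K : comNzRingType) (e : 'I_n -> K) :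
    {poly {mpoly K[n]}} -> {poly {mpoly K[n]}} :=
  horner_eval 'X \o
    map_poly (line_poly (@mpolyC n K) (fun i => 'X_i) (fun i => (e i)%:MP)).

HB.instance Definition _ n K e :=
  GRing.RMorphism.copy (@shift_poly n K e)
   (horner_eval 'X \o
    map_poly (line_poly (@mpolyC n K) (fun i => 'X_i) (fun i => (e i)%:MP))).

Lemma shift_polyC (n : nat) (K : comNzRingType) (e : 'I_n -> K) p :
  shift_poly e p%:P =
  line_poly (@mpolyC n K) (fun i => 'X_i) (fun i => (e i)%:MP) p.
Proof. by rewrite /shift_poly /= map_polyC /horner_eval hornerC. Qed.

Lemma shift_polyX (n : nat) (K : comNzRingType) (e : 'I_n -> K) :
  shift_poly e 'X = 'X.
Proof. by rewrite /shift_poly /= map_polyX /horner_eval hornerX. Qed.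

Lemma shift_line_poly (n : nat) (K : comNzRingType) (e1 e2 : 'I_n -> K) p :
  (forall i, e1 i + e2 i = 0) ->
  shift_poly e1
    (line_poly (@mpolyC n K) (fun i => 'X_i) (fun i => (e2 i)%:MP) p) = p%:P.
Proof.
move=> e12.
rewrite -[LHS]/((shift_poly e1 \o line_poly (@mpolyC n K)
   (fun i => 'X_i) (fun i => (e2 i)%:MP)) p).
apply: mpoly_rmorph_eq => [c|i] /=.
  by rewrite line_polyC shift_polyC line_polyC.
rewrite line_polyX rmorphD rmorphM /= !shift_polyC shift_polyX.
rewrite line_polyX line_polyC -addrA -mulrDl -polyCD -mpolyCD e12.
by rewrite mpolyC0 mul0r addr0.
Qed.

Lemma poly_rmorph_eq (A S : comNzRingType) (f g : {rmorphism {poly A} -> S}) :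
  (forall c, f c%:P = g c%:P) -> f 'X = g 'X -> f =1 g.
Proof.
move=> fgC fgX; elim/poly_ind => [|w c IH]; first by rewrite !rmorph0.
by rewrite !rmorphD !rmorphM IH fgX fgC.
Qed.

Lemma shift_polyK (n : nat) (K : comNzRingType) (e1 e2 : 'I_n -> K) :
  (forall i, e1 i + e2 i = 0) -> cancel (shift_poly e2) (shift_poly e1).
Proof.
move=> e12; apply: (@poly_rmorph_eq _ _ (shift_poly e1 \o shift_poly e2) idfun).
  move=> c; change (shift_poly e1 (shift_poly e2 c%:P) = c%:P).
  by rewrite shift_polyC shift_line_poly.
by change (shift_poly e1 (shift_poly e2 'X) = 'X); rewrite !shift_polyX.
Qed.

(** The shift by [- e] is a ring automorphism that carries [H] back to the constant [h], where
    [reduced_polyC] applies. *)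
Lemma reduced_line_poly (n : nat) (K : numFieldType) (h : {mpoly K[n]})
    (e : 'I_n -> K) (w v : {poly {mpoly K[n]}}) :
  let H := line_poly (@mpolyC n K) (fun i => 'X_i) (fun i => (e i)%:MP) h in
  reduced h -> w ^+ 2 = v * H -> exists v', w = v' * H.
Proof.
move=> H hred wv; pose e' i := - e i.
have ee' i : e i + e' i = 0 by rewrite subrr.
have e'e i : e' i + e i = 0 by rewrite addNr.
have [v' Ev] : exists v', shift_poly e' w = v' * h%:P.
  apply: (reduced_polyC (v := shift_poly e' v)) => //.
  by rewrite -rmorphXn wv rmorphM /= [shift_poly e' H]shift_line_poly.
exists (shift_poly e v').
by rewrite -[LHS](shift_polyK ee') Ev rmorphM /= shift_polyC.
Qed.

Lemma mmap_mpolyC (n : nat) (K : comNzRingType) (e : 'I_n -> K) p :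
  mmap (@mpolyC n K) (fun i => (e i)%:MP) p = p.@[e]%:MP.
Proof.
apply: (@mpoly_rmorph_eq _ _ _ (mmap (@mpolyC n K) (fun i => (e i)%:MP))
  (@mpolyC n K \o meval e)) => [c|i].
  by rewrite [LHS]mmapC /= mevalC.
by rewrite [LHS]mmapX mmap1U /= mevalXU.
Qed.

(* If [g ^+ 2] divides [c *: H] with cofactor [q], then [H] divides
   [(q * g) ^+ 2], hence [q * g] by reducedness, so [g] divides [c]. *)
Lemma separable_line_poly (n d : nat) (K : numFieldType) (h : {mpoly K[n]})
    (e : 'I_n -> K) :
  h \is d.-homog -> reduced h -> h.@[e] != 0 ->
  separable_poly
    (line_poly (@mpolyC n K) (fun i => 'X_i) (fun i => (e i)%:MP) h).
Proof.
move=> hh hred he; set H := line_poly _ _ _ _.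
have H0 : H != 0.
  have [_ cH] := line_poly_homog (@mpolyC n K) (fun i => 'X_i)
    (fun i => (e i)%:MP) hh.
  apply: contraNneq he => H0; move: cH; rewrite -/H H0 coef0 mmap_mpolyC.
  by move/esym/eqP; rewrite mpolyC_eq0.
apply/separable_polyP; split=> [u v uvH|u _ su]; last first.
  (* A nonconstant [u] has nonzero derivative in characteristic zero: the coefficient of the
     derivative at index [(size u).-2] is the leading coefficient of [u] times [(size u).-1]. *)
  have su1 : (0 < (size u).-1)%N by rewrite -ltnS prednK // ltnW.
  apply/eqP => /polyP/(_ (size u).-2); rewrite coef_deriv coef0 prednK //.
  move/mpolyP => u0; have : lead_coef u != 0.
    by rewrite lead_coef_eq0 -size_poly_gt0 ltnW.
  apply/negP; rewrite negbK; apply/eqP/mpolyP => m; have := u0 m.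
  rewrite mcoeffMn mcoeff0 => /eqP; rewrite mulrn_eq0 /=.
  by rewrite eqn0Ngt su1 => /eqP.
rewrite coprimep_def; set g := gcdp u v.
have /Pdiv.Idomain.dvdpP [[c q] /= c0 E] : g * g %| H.
  by apply: dvdp_trans uvH; rewrite dvdp_mul ?dvdp_gcdl ?dvdp_gcdr.
have [q' Eq] : exists q', q * g = q' * H.
  apply: (reduced_line_poly (v := c *: q)) => //.
  rewrite -/H -scalerAl [q * H]mulrC scalerAl E expr2 !mulrA.
  by rewrite [LHS]mulrAC.
have gc : g %| c%:P.
  suff -> : c%:P = q' * g by rewrite dvdp_mull.
  by apply: (mulIf H0); rewrite mul_polyC E mulrA Eq mulrAC.
have cP0 : c%:P != 0 by rewrite polyC_eq0.
rewrite eqn_leq (leq_trans (dvdp_leq cP0 gc)) ?size_polyC_leq1 //.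
by rewrite size_poly_gt0; apply: contraNneq cP0 => g0; rewrite -dvd0p -g0.
Qed.

(* On a generic line of direction [e], [h] has [d] distinct zeros while [q] has
   degree less than [d]; the Bezout identity [u * H + v * H^`() = D%:P] makes
   [D != 0] the genericity condition. *)
Lemma vanishing_eq0 (n d : nat) (K : numClosedFieldType) (h q : {mpoly K[n]})
    (e : 'I_n -> K) :
  h \is d.-homog -> reduced h -> h.@[e] != 0 ->
  (forall y, (size (line_poly idfun y e q) <= d)%N) ->
  (forall x, h.@[x] = 0 -> q.@[x] = 0) -> q = 0.
Proof.
move=> hh hred he sq qh; have := separable_line_poly hh hred he.
rewrite unlock => /Bezout_coprimepP [[u v] /=]; set H := line_poly _ _ _ _.
rewrite -size_poly_eq1 => /size_poly1P [D D0 uvD].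
(* The factor [D] disposes of the base points [y] with [D (y) = 0], whose lines may fail to be
   generic; it cancels in the end because [D] is nonzero. *)
suff Dq : D * q = 0.
  by move/eqP: Dq; rewrite mulf_eq0 (negbTE D0) => /eqP.
apply: mpoly_meval_eq0 => y; rewrite mevalM; apply/eqP; rewrite mulf_eq0.
have [//|Dy] := eqVneq; apply/eqP.
have HyE : map_poly (meval y) H = line_poly idfun y e h by rewrite map_line_poly.
have sepy : separable_poly (line_poly idfun y e h).
  rewrite unlock; apply/Bezout_coprimepP.
  exists (map_poly (meval y) u, map_poly (meval y) v) => /=.
  rewrite -HyE deriv_map -!rmorphM -rmorphD uvD /= map_polyC /=.
  by rewrite -size_poly_eq1 size_polyC Dy.
have [_ cHy] := line_poly_homog idfun y e hh.
have [sHy _] := line_poly_homog idfun y e hh.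
have szHy : size (line_poly idfun y e h) = d.+1.
  apply/eqP; rewrite eqn_leq sHy ltnNge; apply: contra he => s.
  by rewrite -[h.@[e]]cHy nth_default.
have [rs Ers] := closed_field_poly_normal (line_poly idfun y e h).
have lc0 : lead_coef (line_poly idfun y e h) != 0.
  by rewrite lead_coef_eq0 -size_poly_eq0 szHy.
have srs : size rs = d.
  by apply: succn_inj; rewrite -szHy Ers size_scale // size_prod_XsubC.
have urs : uniq rs.
  move: sepy; rewrite Ers (eqp_separable (eqp_scale _ lc0)).
  by rewrite separable_prod_XsubC.
have q0 : line_poly idfun y e q = 0.
  apply: (@roots_geq_poly_eq0 _ _ rs) => //; last by rewrite srs.
  apply/allP => z zrs; rewrite rootE horner_line_poly; apply/eqP/qh.
  by rewrite -horner_line_poly Ers hornerZ; apply/eqP; rewrite mulf_eq0 -rootE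
    root_prod_XsubC zrs orbT.
have := horner_line_poly y e q 0; rewrite q0 horner0 => ->.
by apply: meval_eq => i; rewrite mulr0 addr0.
Qed.

Lemma vanishing_lt_eq0 (n d m : nat) (K : numClosedFieldType)
    (h q : {mpoly K[n]}) :
  h != 0 -> h \is d.-homog -> reduced h -> q \is m.-homog -> (m < d)%N ->
  (forall x, h.@[x] = 0 -> q.@[x] = 0) -> q = 0.
Proof.
move=> h0 hh hred qq md qh.
have [e he] := mpoly_neq0_meval h0.
apply: (vanishing_eq0 hh hred he _ qh) => y.
by have [s _] := line_poly_homog idfun y e qq; exact: leq_trans s md.
Qed.

(** The multiple of [h] is chosen so that the difference vanishes at [e]. On each line of direction
    [e] the difference then loses its term of degree [d], as [vanishing_eq0] requires. *)
Lemma vanishing_proportional (n d : nat) (K : numClosedFieldType)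
    (h q : {mpoly K[n]}) :
  h != 0 -> h \is d.-homog -> reduced h -> q \is d.-homog ->
  (forall x, h.@[x] = 0 -> q.@[x] = 0) -> exists c, q = c *: h.
Proof.
move=> h0 hh hred qq qh.
have [e he] := mpoly_neq0_meval h0.
exists (q.@[e] / h.@[e]); apply/eqP; rewrite -subr_eq0; apply/eqP.
apply: (vanishing_eq0 hh hred he) => [y|x hx]; last first.
  by rewrite mevalB mevalZ qh // hx mulr0 subrr.
have [|s c] := @line_poly_homog n d K K idfun y e (q - (q.@[e] / h.@[e]) *: h).
  by rewrite rpredB // rpredZ.
apply/leq_sizeP => j; rewrite leq_eqVlt => /orP[/eqP <-|dj].
  by rewrite c -[mmap _ _ _]/(meval e _) mevalB mevalZ divfK // subrr.
by rewrite nth_default // (leq_trans s).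
Qed.

(** * First-order expansions *)

Lemma cvg_norm_le (K : numFieldType) (u : nat -> K) (l c B : K) :
  u @ \oo --> l -> (\forall N \near \oo, `|u N - c| <= B) -> `|l - c| <= B.
Proof.
move=> ul uB.
have B_ge0 : 0 <= B.
  by have /filter_ex [N] := uB; apply: le_trans; rewrite normr_ge0.
rewrite real_leNgt ?normr_real ?ger0_real //; apply/negP => Bl.
have e0 : 0 < `|l - c| - B by rewrite subr_gt0.
move/cvgrPdist_lt: ul => /(_ _ e0) ul.
have [N [lN cN]] := filter_ex (filterI ul uB).
suff : `|l - c| < `|l - c| by rewrite ltxx.
apply: le_lt_trans (_ : _ <= `|l - u N| + `|u N - c|) _.
  by rewrite -[l - c](subrKA (u N)) ler_normD.
by rewrite -ltrBrDr (lt_le_trans lN) // lerB.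
Qed.

(** Only monomials divisible by [s] survive in the difference of the two values of [g]; [b] and
    [L i] are the coefficients of [s] and [s x_i]. Every other surviving monomial is divisible by
    [s ^+ 2], or by [s] times a quadratic monomial in [x], and absolute convergence at [rho] bounds
    their sum. *)
Lemma analytic_first_order (K : numFieldType) (n : nat)
    (g : 'rV[K]_(n + 1) -> K) (a : 'rV[K]_n) :
  analytic_at g (row_mx a 0) ->
  exists (b : K) (L : 'I_n -> K) (C r : K), [/\ 0 <= C, 0 < r &
    forall (x : 'rV[K]_n) (s e : K),
      0 <= e -> e < r -> (forall i, `|x 0 i| <= e) -> `|s| < r ->
      `|g (row_mx (a + x) s%:M) - g (row_mx (a + x) 0)
        - s * (b + \sum_i L i * x 0 i)| <= C * (`|s| * e ^+ 2 + `|s| ^+ 2)].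
Proof.
move=> [c [rho [M [rho0 cM gE]]]].
pose j0 : 'I_(n + 1) := rshift n ord0.
pose m1 := (U_(j0))%MM : 'X_{1..(n + 1)}.
pose m2 i := (U_(j0) + U_(lshift 1 i))%MM : 'X_{1..(n + 1)}.
have M0 : 0 <= M.
  apply: le_trans (cM 0%N); apply: sumr_ge0 => m _.
  by rewrite mulr_ge0 // exprn_ge0 // ltW.
(* The powers [rho ^- 3] and [rho ^- 2] arise by pulling the lowest remaining monomials, [s x_i x_j]
   of degree 3 and [s ^+ 2] of degree 2, out of the series. *)
exists (c m1), (fun i => c (m2 i)), (M * (rho ^- 3 + rho ^- 2)), rho.
split=> // [|x s e e0 er xe sr].
  by rewrite mulr_ge0 // addr_ge0 ?invr_ge0 ?exprn_ge0 // ltW.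
pose B := `|s| * e ^+ 2 / rho ^+ 3 + `|s| ^+ 2 / rho ^+ 2.
have B0 : 0 <= B.
  by rewrite addr_ge0 ?mulr_ge0 ?exprn_ge0 ?invr_ge0 ?exprn_ge0 // ltW.
apply: le_trans (_ : M * B <= _); last first.
  rewrite -mulrA ler_wpM2l // mulrDl !mulrDr.
  have A1 : 0 <= `|s| * e ^+ 2 by rewrite mulr_ge0 ?exprn_ge0.
  have r0 k : 0 <= rho ^- k by rewrite invr_ge0 exprn_ge0 // ltW.
  apply: lerD; rewrite mulrC; first by rewrite lerDl mulr_ge0 ?exprn_ge0.
  by rewrite lerDr mulr_ge0.
pose mono (s : K) (m : 'X_{1..(n + 1)}) := \prod_(i < n + 1) row_mx x s%:M 0 i ^+ m i.
have monoE s1 m : mono s1 m = (\prod_(i < n) x 0 i ^+ m (lshift 1 i)) * s1 ^+ m j0.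
  rewrite /mono big_split_ord /= big_ord1; congr (_ * _).
    by apply: eq_bigr => i _; rewrite row_mxEl.
  by rewrite row_mxEr mxE eqxx.
have mdE m : mdeg m = (\sum_(i < n) m (lshift 1 i) + m j0)%N.
  by rewrite mdegE big_split_ord big_ord1.
have cvgP s1 : `|s1| < rho ->
    (fun N : nat => \sum_(m : 'X_{1..(n + 1) < N}) c m * mono s1 m) @ \oo
      --> g (row_mx (a + x) s1%:M).
  move=> s1r; have := gE (row_mx x s1%:M); rewrite add_row_mx add0r; apply.
  move=> j; rewrite -(splitK j); case: (split j) => k /=.
    by rewrite row_mxEl (le_lt_trans (xe k)).
  by rewrite row_mxEr ord1 mxE eqxx.
have cvg0 := cvgP 0; rewrite normr0 raddf0 in cvg0.
have cvgs : (fun N : nat => \sum_(m : 'X_{1..(n + 1) < N}) c m * mono s m -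
      \sum_(m : 'X_{1..(n + 1) < N}) c m * mono 0 m) @ \oo
    --> g (row_mx (a + x) s%:M) - g (row_mx (a + x) 0).
  by apply: cvgB; [exact: cvgP|exact: cvg0].
apply: (cvg_norm_le cvgs).
(* [T m] is the share of the monomial [m] in the remainder, without its coefficient. *)
pose T (m : 'X_{1..(n + 1)}) := mono s m - mono 0 m
   - ((m == m1)%:R * s + \sum_(i < n) (m == m2 i)%:R * (s * x 0 i)).
have TB m : `|T m| <= rho ^+ mdeg m * B.
  have rm0 : 0 <= rho ^+ mdeg m by rewrite exprn_ge0 // ltW.
  have r_ge0 : 0 <= rho by rewrite ltW.
  have rhoN0 : rho != 0 by rewrite gt_eqF.
  pose y := \prod_(i < n) x 0 i ^+ m (lshift 1 i).
  pose S := (\sum_(i < n) m (lshift 1 i))%N.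
  have yS : `|y| <= e ^+ S.
    rewrite /y /S -prodrXr normr_prod; apply: ler_prod => i _.
    by rewrite normr_ge0 normrX lerXn2r ?nnegrE.
  have m1j0 : m1 j0 = 1%N by rewrite mnm1E eqxx.
  have lr i : (lshift 1 i == j0) = false by rewrite eq_lrshift.
  have m2j0 i : m2 i j0 = 1%N by rewrite mnmDE !mnm1E eqxx lr.
  have m1l i : m1 (lshift 1 i) = 0%N by rewrite mnm1E eq_sym lr.
  have m2l i k : m2 i (lshift 1 k) = (i == k).
    by rewrite mnmDE !mnm1E eq_sym lr eq_lshift.
  have S1 : m = m1 -> S = 0%N.
    by rewrite /S => ->; rewrite big1.
  have S2 i : m = m2 i -> S = 1%N.
    rewrite /S => ->; rewrite (bigD1 i) //= m2l eqxx big1 // => k.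
    by rewrite m2l eq_sym => /negbTE ->.
  have n1 : m j0 != 1%N -> (m == m1) = false.
    by apply: contraNF => /eqP ->; rewrite m1j0.
  have n2 i : m j0 != 1%N -> (m == m2 i) = false.
    by apply: contraNF => /eqP ->; rewrite m2j0.
  have n1S : S != 0%N -> (m == m1) = false by apply: contraNF => /eqP/S1 ->.
  have n2S i : S != 1%N -> (m == m2 i) = false by apply: contraNF => /eqP/S2 ->.
  (* The cases are: no factor [s], the monomial [s], a monomial [s x_i], and all others. In the
     first three [T m] is zero. *)
  have [[k0 k1]|[k0 S0]|[k0 S0]|m_large] : [\/ m j0 != 1 /\ m j0 = 0,
      m j0 = 1 /\ S = 0, m j0 = 1 /\ S = 1 | (1 < m j0) || ((m j0 == 1) && (1 < S))]%N.
    case: (m j0) => [|[|k]] /=; first by constructor 1.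
      case: (S) => [|[|k]]; [by constructor 2|by constructor 3|by constructor 4].
    by constructor 4.
  - rewrite /T !monoE k1 !expr0 subrr n1 // mul0r add0r big1 => [|i _].
      by rewrite addr0 oppr0 normr0 mulr_ge0.
    by rewrite n2 // mul0r.
  - have mi i : m (lshift 1 i) = 0%N.
      by apply/eqP; move/eqP: S0; rewrite sum_nat_eq0 => /forallP/(_ i).
    have Em : m == m1.
      apply/eqP/mnmP => j; rewrite -(splitK j); case: (split j) => i /=.
        by rewrite mi m1l.
      by rewrite ord1 k0 m1j0.
    rewrite /T !monoE k0 !expr1 Em mul1r mulr0 subr0 [\prod_(_ < _) _]big1 => [|i _].
      rewrite mul1r big1 ?addr0 ?subrr ?normr0 ?mulr_ge0 // => i _.
      by rewrite n2S ?S0 // mul0r.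
    by rewrite mi expr0.
  - pose m' := [multinom m (lshift 1 i) | i < n].
    have /mdeg1P [i /eqP Ei] : mdeg m' == 1%N.
      by rewrite mdegE -S0; apply/eqP/eq_bigr => i _; rewrite mnmE.
    have Em : m = m2 i.
      apply/mnmP => j; rewrite -(splitK j); case: (split j) => l /=.
        by rewrite m2l -mnm1E -Ei mnmE.
      by rewrite ord1 k0 m2j0.
    have yE : \prod_(l < n) x 0 l ^+ m (lshift 1 l) = x 0 i.
      rewrite (bigD1 i) //= Em m2l eqxx expr1 big1 ?mulr1 // => l.
      by rewrite m2l eq_sym => /negbTE ->; rewrite expr0.
    rewrite /T !monoE k0 !expr1 yE n1S ?S0 // mul0r add0r mulr0 subr0.
    rewrite (bigD1 i) //= Em eqxx mul1r big1 ?addr0 => [|l li].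
      by rewrite mulrC subrr normr0 mulr_ge0 // -Em.
    have /negbTE -> : m2 i != m2 l; last by rewrite mul0r.
    apply: contraNneq li => /mnmP/(_ (lshift 1 i)); rewrite !m2l eqxx.
    by case: eqP.
  have -> : T m = y * s ^+ m j0.
    rewrite /T !monoE; have m0 : (0 < m j0)%N.
      by case/orP: m_large => [/ltnW //|/andP[/eqP -> _]].
    rewrite expr0n eqn0Ngt m0 mulr0 subr0.
    have F1 : (m == m1) = false.
      case/orP: m_large => [k2|/andP[_ S2']]; first by rewrite n1 // gtn_eqF.
      by rewrite n1S // -lt0n ltnW.
    have F2 i : (m == m2 i) = false.
      case/orP: m_large => [k2|/andP[_ S2']]; first by rewrite n2 // gtn_eqF.
      by rewrite n2S // gtn_eqF.
    rewrite F1 mul0r add0r [\sum_(_ < _) _]big1 ?subr0 // => i _.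
    by rewrite F2 mul0r.
  rewrite normrM normrX mdE -/S.
  (* If [s] occurs at least twice, two factors [s] are kept and all others bounded by [rho];
     otherwise the single factor [s] and two coordinates of [x] are kept. *)
  case/orP: m_large => [k2|/andP[/eqP -> S2']].
    apply: le_trans (_ : rho ^+ (S + m j0) * (`|s| ^+ 2 / rho ^+ 2) <= _).
      rewrite -(subnK k2) addnA [rho ^+ (_ + 2)]exprD -mulrA.
      rewrite [rho ^+ 2 * _]mulrCA divff ?expf_neq0 // mulr1 !exprD -mulrA.
      apply: ler_pM; rewrite ?mulr_ge0 ?exprn_ge0 //.
        by apply: le_trans yS _; rewrite lerXn2r ?nnegrE // ltW.
      by rewrite ler_wpM2r ?exprn_ge0 // lerXn2r ?nnegrE // ltW.
    by rewrite ler_wpM2l ?exprn_ge0 // /B lerDr !mulr_ge0 ?invr_ge0 ?exprn_ge0.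
  apply: le_trans (_ : rho ^+ (S + 1) * (`|s| * e ^+ 2 / rho ^+ 3) <= _).
    have -> : (S + 1 = (S - 2) + 3)%N by rewrite -[in LHS](subnK S2') -addnA.
    rewrite exprD -mulrA [rho ^+ 3 * _]mulrCA divff ?expf_neq0 // mulr1 expr1.
    rewrite mulrC mulrCA ler_wpM2l //; apply: le_trans yS _.
    rewrite -[in leLHS](subnK S2') exprD ler_wpM2r ?exprn_ge0 //.
    by rewrite lerXn2r ?nnegrE // ltW.
  by rewrite ler_wpM2l ?exprn_ge0 // /B lerDl !mulr_ge0 ?invr_ge0 ?exprn_ge0.
(* Truncation keeps the degrees less than [N], so [m1] and [m2 i], of degrees 1 and 2, are present
   from [N = 3] on. *)
exists 3%N => // N /= N3.
have -> : s * (c m1 + \sum_i c (m2 i) * x 0 i) =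
  \sum_(m : 'X_{1..(n + 1) < N}) c m * ((m == m1 :> 'X_{1..(n + 1)})%:R * s +
     \sum_(i < n) (m == m2 i :> 'X_{1..(n + 1)})%:R * (s * x 0 i)).
  have sumE m0 k : (mdeg m0 < N)%N -> \sum_(m : 'X_{1..(n + 1) < N})
      c m * ((m == m0 :> 'X_{1..(n + 1)})%:R * k) = c m0 * k.
    move=> m0N; rewrite (bigD1 (BMultinom m0N)) //= eqxx mul1r big1 ?addr0 //.
    by move=> m /negbTE; rewrite -val_eqE /= => ->; rewrite mul0r mulr0.
  under [RHS]eq_bigr do rewrite mulrDr mulr_sumr.
  rewrite big_split exchange_big /= sumE; last first.
    by rewrite mdeg1 (leq_trans _ N3).
  rewrite mulrDr [s * c m1]mulrC mulr_sumr; congr (_ + _); apply: eq_bigr => i _.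
  by rewrite sumE ?mdegD ?mdeg1 // mulrCA.
rewrite -sumrB -sumrB; apply: le_trans (ler_norm_sum _ _ _) _.
apply: le_trans (_ : (\sum_(m : 'X_{1..(n + 1) < N}) `|c m| * rho ^+ mdeg m) * B <= _).
  rewrite mulr_suml; apply: ler_sum => m _; rewrite -mulrBr -mulrBr normrM -mulrA.
  by rewrite ler_wpM2l //; exact: TB.
by rewrite ler_wpM2r.
Qed.

(** [u l = O (l ^ k)] as [l] tends to 0; for [k > 0] this includes [u 0 = 0]. *)
Definition isO (K : numFieldType) (k : nat) (u : K -> K) : Prop :=
  exists2 C, 0 <= C & \forall l \near 0, `|u l| <= C * `|l| ^+ k.

Lemma isO_ext (K : numFieldType) k (u v : K -> K) :
  (\forall l \near 0, u l = v l) -> isO k u -> isO k v.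
Proof.
move=> uv [C C0 uC]; exists C => //; near=> l.
by have <- : u l = v l; near: l.
Unshelve. all: by end_near. Qed.

Lemma isO0 (K : numFieldType) k : isO k (fun=> 0 : K).
Proof. by exists 0 => //; near=> l; rewrite normr0 mul0r.
Unshelve. all: by end_near. Qed.

Lemma isO_cst (K : numFieldType) (c : K) : isO 0 (fun=> c).
Proof. by exists `|c| => //; near=> l; rewrite expr0 mulr1.
Unshelve. all: by end_near. Qed.

Lemma isOX (K : numFieldType) k : isO k (fun l : K => l ^+ k).
Proof. by exists 1 => //; near=> l; rewrite normrX mul1r.
Unshelve. all: by end_near. Qed.

Lemma isOD (K : numFieldType) k (u v : K -> K) :
  isO k u -> isO k v -> isO k (fun l => u l + v l).
Proof.
move=> [C C0 uC] [D D0 vD]; exists (C + D); first exact: addr_ge0.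
near=> l; apply: le_trans (ler_normD _ _) _; rewrite mulrDl.
by apply: lerD; near: l.
Unshelve. all: by end_near. Qed.

Lemma isOM (K : numFieldType) k m (u v : K -> K) :
  isO k u -> isO m v -> isO (k + m) (fun l => u l * v l).
Proof.
move=> [C C0 uC] [D D0 vD]; exists (C * D); first exact: mulr_ge0.
near=> l; rewrite normrM exprD mulrACA.
by apply: ler_pM => //; near: l.
Unshelve. all: by end_near. Qed.

Lemma isON (K : numFieldType) k (u : K -> K) :
  isO k u -> isO k (fun l => - u l).
Proof. by move=> [C C0 uC]; exists C => //; near=> l; rewrite normrN; near: l.
Unshelve. all: by end_near. Qed.

Lemma isOB (K : numFieldType) k (u v : K -> K) :
  isO k u -> isO k v -> isO k (fun l => u l - v l).
Proof. by move=> uO vO; apply: isOD => //; apply: isON. Qed.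

Lemma isO_sum (K : numFieldType) k n (u : 'I_n -> K -> K) :
  (forall i, isO k (u i)) -> isO k (fun l => \sum_(i < n) u i l).
Proof.
move=> uO; elim: n u uO => [|n IH] u uO.
  by apply: isO_ext (isO0 _ _); near=> l; rewrite big_ord0.
apply: isO_ext (isOD (uO ord0) (IH _ (fun i => uO (lift ord0 i)))).
by near=> l; rewrite big_ord_recl.
Unshelve. all: by end_near. Qed.

Lemma isO_le (K : numFieldType) k m (u : K -> K) :
  (m <= k)%N -> isO k u -> isO m u.
Proof.
move=> mk [C C0 uC]; exists C => //.
have l1 : \forall l \near (0 : K), `|l| < 1 by exact: nbhs0_lt.
near=> l; apply: le_trans (_ : C * `|l| ^+ k <= _); first by near: l.
have l_le1 : `|l| <= 1 by apply: ltW; near: l.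
by rewrite ler_wpM2l // ler_wiXn2l.
Unshelve. all: by end_near. Qed.

(** Dividing by [l ^+ k] leaves [|c| <= C |l|], which fails for a small positive [l] if [c] is
    nonzero. *)
Lemma isO_coef_eq0 (K : numFieldType) k (c : K) :
  isO k.+1 (fun l => l ^+ k * c) -> c = 0.
Proof.
move=> [C C0 cC]; apply/eqP; apply: contraT => c0.
have e0 : 0 < `|c| / (C + 1) by rewrite divr_gt0 ?normr_gt0 // ltr_wpDl.
have le : \forall l \near (0 : K), `|l| < `|c| / (C + 1) by exact: nbhs0_lt.
have /nbhs_ballP [r /= r0 H] : \forall l \near (0 : K),
    `|l ^+ k * c| <= C * `|l| ^+ k.+1 /\ `|l| < `|c| / (C + 1).
  exact: filterI.
have r2 : 0 < r / 2 by rewrite divr_gt0.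
have [] := H (r / 2).
  rewrite -ball_normE /= sub0r normrN gtr0_norm //.
  by rewrite ltr_pdivrMr // ltr_pMr // ltr1n.
rewrite normrM normrX (gtr0_norm r2) exprSr mulrCA.
rewrite ler_pM2l ?exprn_gt0 // => cr rc.
have : `|c| < `|c|; last by rewrite ltxx.
rewrite ltr_pdivlMr ?ltr_wpDl // in rc.
apply: le_lt_trans cr (le_lt_trans _ rc).
by rewrite mulrC ler_wpM2l ?lerDl // ltW.
Unshelve. all: by end_near. Qed.

(** This turns estimates into identities: the two lowest coefficients in [l] vanish one after the
    other. *)
Lemma isO_affine_eq0 (K : numFieldType) k (c d : K) :
  isO k.+2 (fun l => l ^+ k * (c + l * d)) -> c = 0 /\ d = 0.
Proof.
move=> cdO.
have c0 : c = 0.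
  apply: (@isO_coef_eq0 _ k).
  have dO : isO k.+1 (fun l : K => l ^+ k.+1 * d).
    by rewrite -[k.+1]addn0; apply: isOM (isO_cst _); rewrite addn0; exact: isOX.
  apply: isO_ext (isOB (isO_le (leqnSn _) cdO) dO); near=> l.
  by rewrite mulrDr mulrA -exprSr addrK.
split=> //; apply: (@isO_coef_eq0 _ k.+1); apply: isO_ext cdO; near=> l.
by rewrite c0 add0r mulrA -exprSr.
Unshelve. all: by end_near. Qed.

Lemma isO_meval (K : numFieldType) n (p : {mpoly K[n]}) (x : K -> 'I_n -> K) :
  (forall i, isO 0 (x^~ i)) -> isO 0 (fun l => p.@[x l]).
Proof.
move=> xO; elim/mpoly_ring_ind: p => [c|i|p q Ep Eq|p q Ep Eq].
- by apply: isO_ext (isO_cst c); near=> l; rewrite mevalC.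
- by apply: isO_ext (xO i); near=> l; rewrite mevalXU.
- by apply: isO_ext (isOD Ep Eq); near=> l; rewrite mevalD.
- by apply: isO_ext (isOM Ep Eq); near=> l; rewrite mevalM.
Unshelve. all: by end_near. Qed.

(** With [R] the first-order Taylor remainder and [dp] the linear term of [p], the product step is
    [R (p q) = R (p) q (x + u) + p (x) R (q) + dp (q (x + u) - q (x))], where the last difference is
    again [R (q) + dq]. *)
Lemma isO_taylor (K : numFieldType) n (p : {mpoly K[n]}) k
    (x u : K -> 'I_n -> K) :
  (forall i, isO 0 (x^~ i)) -> (forall i, isO k (u^~ i)) ->
  isO (k + k) (fun l => p.@[fun i => x l i + u l i] - p.@[x l]
    - \sum_(i < n) u l i * p^`M(i).@[x l]).
Proof.
move=> xO uO.
have xuO i : isO 0 (fun l => x l i + u l i).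
  exact: isOD (isO_le (leq0n k) (uO i)).
have dO p1 : isO k (fun l => \sum_(i < n) u l i * p1^`M(i).@[x l]).
  by apply: isO_sum => i; rewrite -[k]addn0; apply: isOM => //; exact: isO_meval.
elim/mpoly_ring_ind: p => [c|j|p q Ep Eq|p q Ep Eq].
- apply: isO_ext (isO0 _ _); near=> l; rewrite !mevalC subrr add0r big1 ?oppr0 //.
  by move=> i _; rewrite mderivC meval0 mulr0.
- apply: isO_ext (isO0 _ _); near=> l; rewrite !mevalXU [x l j + _]addrC addrK.
  rewrite (bigD1 j) //= mderivX mnm1E eqxx -{1}[U_(j)%MM]add0m addmK mpolyX0.
  rewrite scale1r meval1 mulr1 big1 ?addr0 ?subrr // => i ij; rewrite mderivX mnm1E.
  by rewrite eq_sym (negbTE ij) scale0r meval0 mulr0.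
- apply: isO_ext (isOD Ep Eq); near=> l; rewrite !mevalD.
  rewrite [in RHS](eq_bigr (fun i => u l i * p^`M(i).@[x l] +
    u l i * q^`M(i).@[x l])); last by move=> i _; rewrite mderivD mevalD mulrDr.
  by rewrite big_split /=; ring.
- have qO := isO_meval q xuO.
  have pO := isO_meval p xO.
  have Ep' := isOM Ep qO; rewrite addn0 in Ep'.
  have Eq' := isOM pO Eq; rewrite add0n in Eq'.
  have dq := isOM (dO p) (isOD (isO_le (leq_addr k k) Eq) (dO q)).
  apply: isO_ext (isOD (isOD Ep' Eq') dq); near=> l; rewrite !mevalM.
  rewrite [in RHS](eq_bigr (fun i => u l i * p^`M(i).@[x l] * q.@[x l] +
    p.@[x l] * (u l i * q^`M(i).@[x l]))); last first.
    by move=> i _; rewrite mderivM mevalD !mevalM mulrDr mulrA mulrCA.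
  by rewrite big_split /= -mulr_suml -mulr_sumr; ring.
Unshelve. all: by end_near. Qed.

Lemma isO1_lt (K : numFieldType) (u : K -> K) (e : K) :
  isO 1 u -> 0 < e -> \forall l \near 0, `|u l| < e.
Proof.
move=> [C C0 uC] e0.
have le : \forall l \near (0 : K), `|l| < e / (C + 1).
  by apply: nbhs0_lt; rewrite divr_gt0 // ltr_wpDl.
near=> l; apply: (@le_lt_trans _ _ (C * `|l| ^+ 1)); first by near: l.
have : `|l| < e / (C + 1) by near: l.
rewrite ltr_pdivlMr ?ltr_wpDl //; apply: le_lt_trans.
by rewrite expr1 mulrC ler_wpM2l // lerDl.
Unshelve. all: by end_near. Qed.

(** A property of germs at [a] may be evaluated along any curve [z] with [z l - a] of order [l]. The
    identities of a trivialisation are used in this way. *)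
Lemma isO1_near (K : numFieldType) m (a : 'rV[K]_m) (z : K -> 'rV[K]_m)
    (P : set 'rV[K]_m) :
  (forall j, isO 1 (fun l => z l 0 j - a 0 j)) ->
  (\forall y \near a, P y) -> \forall l \near 0, P (z l).
Proof.
move=> zO /nbhs_ballP [e /= e0 aP].
have ze : \forall l \near (0 : K), forall j, `|z l 0 j - a 0 j| < e.
  apply: (@filter_forall K _ (fun j l => `|z l 0 j - a 0 j| < e) (nbhs (0 : K))) => j.
  exact: isO1_lt (zO j) e0.
near=> l; have zl : forall j, `|z l 0 j - a 0 j| < e by near: l.
by apply: aP; split=> // i j; rewrite ord1 -ball_normE /= distrC.
Unshelve. all: by end_near. Qed.

Lemma isO1_bounded (K : numFieldType) n (x : K -> 'rV[K]_n) :
  (forall i, isO 1 (fun l => x l 0 i)) ->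
  exists2 C, 0 <= C & \forall l \near 0, forall i, `|x l 0 i| <= C * `|l|.
Proof.
move=> xO; have /choice [C CP] : forall i, exists C : K, 0 <= C /\
    \forall l \near 0, `|x l 0 i| <= C * `|l|.
  by move=> i; have [C C0 xC] := xO i; exists C.
exists (\sum_i C i) => [|]; first by apply: sumr_ge0 => i _; have [] := CP i.
apply: (@filter_forall K _ (fun i l => `|x l 0 i| <= (\sum_i C i) * `|l|)
  (nbhs (0 : K))) => i.
have [C0 xC] := CP i; apply: filterS xC => l /= xC.
apply: le_trans xC _; rewrite ler_wpM2r // (bigD1 i) //= lerDl.
by apply: sumr_ge0 => j _; have [] := CP j.
Qed.

(** With [x] of order [l] and [s = l ^+ k], the two error terms have orders [k + 2] and [2k]; the
    condition [2 <= k] makes the first dominate. *)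
Lemma analytic_first_order_isO (K : numFieldType) (n : nat)
    (g : 'rV[K]_(n + 1) -> K) (a : 'rV[K]_n) :
  analytic_at g (row_mx a 0) ->
  exists (b : K) (L : 'I_n -> K), forall (x : K -> 'rV[K]_n) k, (2 <= k)%N ->
    (forall i, isO 1 (fun l => x l 0 i)) ->
    isO (k + 2) (fun l => g (row_mx (a + x l) (l ^+ k)%:M)
      - g (row_mx (a + x l) 0) - l ^+ k * (b + \sum_i L i * x l 0 i)).
Proof.
move=> /analytic_first_order [b [L [C [r [C0 r0 gE]]]]]; exists b, L => x k k2.
move=> /isO1_bounded [D D0 xD]; exists (C * (D ^+ 2 + 1)).
  by rewrite mulr_ge0 // addr_ge0 // exprn_ge0.
have l1 : \forall l \near (0 : K), `|l| < 1 by exact: nbhs0_lt.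
have lr : \forall l \near (0 : K), `|l| < r by exact: nbhs0_lt.
have lD : \forall l \near (0 : K), `|l| < r / (D + 1).
  by apply: nbhs0_lt; rewrite divr_gt0 // ltr_wpDl.
near=> l.
have l_le1 : `|l| <= 1 by apply: ltW; near: l.
have Dl : D * `|l| < r.
  have : `|l| < r / (D + 1) by near: l.
  rewrite ltr_pdivlMr ?ltr_wpDl //; apply: le_lt_trans.
  by rewrite mulrC ler_wpM2l // lerDl.
apply: le_trans (gE _ _ (D * `|l|) _ _ _ _) _ => //; first by rewrite mulr_ge0.
- by near: l.
- rewrite normrX; apply: (@le_lt_trans _ _ `|l|); last by near: l.
  by rewrite ler_iXnr // -ltnS ltnW.
rewrite -mulrA ler_wpM2l // normrX exprMn mulrDl mul1r.
apply: lerD; first by rewrite mulrCA -exprD.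
by rewrite -exprM ler_wiXn2l // muln2 -addnn leq_add2l.
Unshelve. all: by end_near. Qed.

Lemma analytic_meval (K : numFieldType) n (p : {mpoly K[n]}) :
  analytic_at (fun x : 'rV[K]_n => p.@[x 0]) 0.
Proof.
have pE N (F : 'X_{1..n} -> K) : (forall m, m \notin msupp p -> F m = 0) ->
    \sum_(m : 'X_{1..n < N}) F m = \sum_(m <- msupp p | (mdeg m < N)%N) F m.
  move=> F0; rewrite (big_mksub_cond 'X_{1..n < N}) ?msupp_uniq //=.
  rewrite [RHS]big_mkcond /=; apply: eq_bigr => m _.
  by rewrite bmdeg /=; case: ifPn => // /F0.
exists (fun m => p@_m), 1, (\sum_(m <- msupp p) `|p@_m|); split=> // [N|x _].
  under eq_bigr do rewrite expr1n mulr1.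
  rewrite (pE _ (fun m => `|p@_m|)) => [|m /memN_msupp_eq0 -> ]; last by rewrite normr0.
  rewrite big_mkcond; apply: ler_sum => m _; by case: ifP.
(* The partial sums are stationary once [N] reaches [msize p], which exceeds the degree of every
   monomial of [p]. *)
apply: cvg_near_cst; exists (msize p) => // N /= pN.
rewrite (pE _ (fun m => p@_m * \prod_(i < n) x 0 i ^+ m i)) => [|m /memN_msupp_eq0 ->].
  rewrite add0r mevalE big_seq_cond [RHS]big_seq; apply: eq_bigl => m.
  case mp : (m \in _) => //=.
  by rewrite (leq_trans (msize_mdeg_lt mp)).
by rewrite mul0r.
Qed.

(** * Linear part of right-left stability *)

Lemma isO_scale_mul (K : numFieldType) k (u : K -> K) (c : K) :
  isO k u -> isO k (fun l => u l * c).
Proof. by move=> uO; have := isOM uO (isO_cst c); rewrite addn0. Qed.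

(** Here [f] is any polynomial, so the condition on [f] stays an estimate; homogeneity of [h] alone
    already separates the conditions on [b] and [L]. The scalars [a0] and [a1] form the 1-jet of the
    [s]-derivative of [psi] at [s = 0]. *)
Lemma rl_stable_first_order (K : numFieldType) n N (h f : {mpoly K[n]}) i :
  h \is N.-homog -> rl_stable (fiber h 0) 0 (mpoly_fun f) ->
  exists (b : 'I_n -> K) (L : 'I_n -> 'I_n -> K) (a0 a1 : K) (k : nat),
  forall x : 'rV[K]_n, h.@[x 0] = 0 ->
  [/\ \sum_j b j * h^`M(j).@[x 0] = 0,
      \sum_j (\sum_m L j m * x 0 m) * h^`M(j).@[x 0] = 0
    & isO (k + 2) (fun l => l ^+ k *
       (\sum_j (b j + l * (\sum_m L j m * x 0 m)) *
            f^`M(j).@[fun m => l * x 0 m]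
        + l * x 0 i + (a0 + a1 * (f.@[fun m => l * x 0 m] - f.@[fun=> 0]))))].
Proof.
move=> hh fst.
(* The deformation [f + s * x_i] as a polynomial in [n + 1] variables, the last of which is [s]. *)
pose P := f \mPo [tuple 'X_(lshift 1 j) | j < n] +
  'X_(rshift n ord0) * 'X_(lshift 1 i) : {mpoly K[n + 1]}.
have PE y s : P.@[(row_mx y s : 'rV[K]_(n + 1)) 0] = f.@[y 0] + s 0 0 * y 0 i.
  rewrite mevalD mevalM !mevalXU row_mxEl row_mxEr comp_mpoly_meval.
  congr (_ + _); apply: meval_eq => j.
  by rewrite tnth_mktuple mevalXU row_mxEl.
have [|phi [psi [[phi' [aphi _ phi0 phiX]] [psi' [apsi _ psi0 _]] psiE]]] :=
    fst (mpoly_fun P).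
  split=> [j|].
    rewrite row_mx0; have -> : (fun y => mpoly_fun P y 0 j) = (fun y => P.@[y 0]).
      by apply/funext => y; rewrite mxE.
    exact: analytic_meval.
  by near=> x => _; rewrite /mpoly_fun PE mxE mul0r addr0.
have f0E : mpoly_fun f 0 = const_mx f.@[fun=> 0].
  by rewrite /mpoly_fun; congr const_mx; apply: meval_eq => j; rewrite mxE.
have /choice [b /choice [L bLE]] := fun j => analytic_first_order_isO (aphi j).
have [a0 [A psi1E]] := analytic_first_order_isO (apsi ord0).
(* The choice [k = N + 2] gives the quadratic Taylor remainder, of order [2k], at least the order
   [N.-1 + k + 2] needed below, and ensures [2 <= k] even for [N = 0]. *)
exists b, L, a0, (A ord0), N.+2 => x hx; pose k := N.+2.
have xO j : isO 1 (fun l => (l *: x) 0 j).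
  apply: isO_ext (isO_scale_mul (x 0 j) (isOX K 1)); near=> l.
  by rewrite mxE expr1.
have lxE l : (l *: x) 0 =1 (fun j => l * x 0 j) by move=> j; rewrite mxE.
(* The zero set of [h] is a cone, so the curve [l *: x] stays in it and the identities required
   there may be used. *)
have hlx l : fiber h 0 (l *: x).
  by rewrite /fiber /= (meval_eq _ (lxE l)) (dhomog_meval_scale _ _ hh) hx mulr0.
pose z l : 'rV[K]_(n + 1) := row_mx (l *: x) (l ^+ k)%:M.
have zO j : isO 1 (fun l => z l 0 j - (row_mx 0 0 : 'rV[K]_(n + 1)) 0 j).
  rewrite -(splitK j); case: (split j) => m /=.
    by apply: isO_ext (xO m); near=> l; rewrite !row_mxEl [X in _ - X]mxE subr0.
  apply: isO_ext (isO_le _ (isOX K k)) => //; near=> l.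
  by rewrite !row_mxEr ord1 !mxE eqxx subr0.
have phi0l : \forall l \near 0, phi (row_mx (l *: x) 0) = l *: x.
  have x0 j : isO 1 (fun l => (l *: x) 0 j - (0 : 'rV[K]_n) 0 j).
    by apply: isO_ext (xO j); near=> l; rewrite [X in _ - X]mxE subr0.
  by apply: filterS (isO1_near x0 phi0) => l; apply.
have phizX : \forall l \near 0, h.@[phi (z l) 0] = 0.
  apply: filterS (isO1_near zO phiX) => l; rewrite row_mxKl.
  by case/(_ (hlx l)).
have psiz := isO1_near zO psiE.
(* [u] is the displacement caused by [phi] along the curve, and [l ^+ k * v] its expansion up to
   order [k + 2]. *)
pose u l j := phi (z l) 0 j - l * x 0 j.
pose v l j := b j + l * (\sum_m L j m * x 0 m).
have uvO j : isO (k + 2) (fun l => u l j - l ^+ k * v l j).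
  apply: isO_ext (bLE j _ k isT xO); near=> l.
  rewrite !add0r; have -> : phi (row_mx (l *: x) 0) = l *: x by near: l.
  rewrite /u mxE /v; congr (_ - _ * (_ + _)); rewrite mulr_sumr.
  by apply: eq_bigr => m _; rewrite mxE mulrCA.
have lO0 : isO 0 (fun l : K => l) by exact: isO_le (isOX K 1).
have vO j : isO 0 (fun l => v l j).
  by apply: isOD (isO_cst _) _; apply: isO_scale_mul.
have uO j : isO k (fun l => u l j).
  have := isOM (isOX K k) (vO j); rewrite addn0 => kvO.
  apply: isO_ext (isOD (isO_le (leq_addr 2 k) (uvO j)) kvO); near=> l.
  by rewrite subrK.
have wE l : phi (z l) 0 =1 (fun j => l * x 0 j + u l j).
  by move=> j; rewrite /u addrC subrK.
have lxO j : isO 0 (fun l : K => l * x 0 j) by exact: isO_scale_mul.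
have H : isO (N.-1 + k).+2 (fun l => l ^+ (N.-1 + k) *
    (\sum_j b j * h^`M(j).@[x 0] +
     l * \sum_j (\sum_m L j m * x 0 m) * h^`M(j).@[x 0])).
  (* Since [h] vanishes both at [l *: x] and at [phi (z l)], its linear variation equals minus the
     Taylor remainder. *)
  have T : isO (k + k) (fun l => l ^+ N.-1 * \sum_j u l j * h^`M(j).@[x 0]).
    apply: isO_ext (isON (isO_taylor h lxO uO)); near=> l.
    rewrite -(meval_eq _ (wE l)) -(meval_eq _ (lxE l)).
    have -> : h.@[phi (z l) 0] = 0 by near: l.
    rewrite (hlx l) subrr add0r opprK mulr_sumr; apply: eq_bigr => j _.
    by rewrite (dhomog_meval_scale _ _ (dhomog_mderiv j hh)) mulrCA.
  have V : isO (N.-1 + (k + 2)) (fun l => l ^+ N.-1 *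
      \sum_j (u l j - l ^+ k * v l j) * h^`M(j).@[x 0]).
    by apply: isOM (isOX _ _) _; apply: isO_sum => j; exact: isO_scale_mul.
  have Nk : ((N.-1 + k).+2 <= k + k)%N by rewrite -!addSn leq_add2r !ltnS leq_pred.
  have Nk2 : (N.-1 + (k + 2) = (N.-1 + k).+2)%N by rewrite addn2 !addnS.
  rewrite Nk2 in V.
  apply: isO_ext (isOB (isO_le Nk T) V); near=> l.
  rewrite -mulrBr -sumrB exprD -mulrA; congr (_ * _).
  rewrite [l * _]mulr_sumr -big_split mulr_sumr; apply: eq_bigr => j _ /=.
  by rewrite -mulrBl subKr -mulrA mulrDl mulrA.
have [hb hL] := isO_affine_eq0 H.
split=> //.
pose df l := \sum_j u l j * f^`M(j).@[fun m => l * x 0 m].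
have fO j : isO 0 (fun l => f^`M(j).@[fun m => l * x 0 m]) by exact: isO_meval.
have dfO : isO k df.
  by apply: isO_sum => j; rewrite -[k]addn0; exact: isOM.
have vdfO : isO (k + 2) (fun l => df l -
    l ^+ k * \sum_j v l j * f^`M(j).@[fun m => l * x 0 m]).
  have : isO (k + 2) (fun l => \sum_j (u l j - l ^+ k * v l j) *
      f^`M(j).@[fun m => l * x 0 m]).
    by apply: isO_sum => j; rewrite -[(k + 2)%N]addn0; exact: isOM.
  apply: isO_ext; near=> l; rewrite /df mulr_sumr -sumrB.
  by apply: eq_bigr => j _; rewrite mulrBl mulrA.
have kk : (k + 2 <= k + k)%N by rewrite leq_add2l.
have Tf := isO_taylor f lxO uO.
have wO : isO 0 (fun l => phi (z l) 0 i).
  apply: isO_ext (isOD (lxO i) (isO_le (leq0n _) (uO i))); near=> l.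
  by rewrite -wE.
(* [Y] is the value of the deformation at the displaced point, measured from [f (0)]; this is where
   [psi] is expanded. *)
pose Y l := f.@[phi (z l) 0] + l ^+ k * phi (z l) 0 i - f.@[fun=> 0].
have YO : isO k (fun l => Y l - (f.@[fun m => l * x 0 m] - f.@[fun=> 0])).
  have kw := isOM (isOX K k) wO; rewrite addn0 in kw.
  apply: isO_ext (isOD (isOD (isO_le (leq_addr k k) Tf) dfO) kw); near=> l.
  by rewrite /Y -(meval_eq _ (wE l)) /df; ring.
have f1 : isO 1 (fun l => f.@[fun m => l * x 0 m] - f.@[fun=> 0]).
  have xO1 j : isO 1 (fun l : K => l * x 0 j).
    by apply: isO_ext (xO j); near=> l; rewrite mxE.
  have c0 : forall j : 'I_n, isO 0 (fun l : K => 0 : K) by move=> j; exact: isO0.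
  have d1 : isO 1 (fun l : K => \sum_j (l * x 0 j) * f^`M(j).@[fun=> 0]).
    by apply: isO_sum => j; exact: isO_scale_mul.
  apply: isO_ext (isOD (isO_le (_ : 1 <= 2)%N (isO_taylor f c0 xO1)) d1) => //.
  near=> l; rewrite subrK; congr (_ - _).
  by apply: meval_eq => j; rewrite add0r.
have Y1 : isO 1 Y.
  by apply: isO_ext (isOD (isO_le _ YO) f1) => //; near=> l; rewrite subrK.
have YM (j : 'I_1) : isO 1 (fun l => (Y l)%:M 0 j : K).
  by apply: isO_ext Y1; near=> l; rewrite (ord1 j) mxE eqxx.
have f0Y l : mpoly_fun f 0 + (Y l)%:M =
    mpoly_fun P (row_mx (phi (z l)) (l ^+ k)%:M).
  apply/matrixP => j m; rewrite f0E (ord1 j) (ord1 m) !mxE PE mxE eqxx mulr1n.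
  by rewrite addrC subrK.
have psizl : \forall l \near 0,
    psi (row_mx (mpoly_fun f 0 + (Y l)%:M) (l ^+ k)%:M) = mpoly_fun f (l *: x).
  apply: filterS psiz => l; rewrite row_mxKl => /(_ (hlx l)).
  by rewrite /with_param !row_mxKr f0Y.
have psi0l : \forall l \near 0,
    psi (row_mx (mpoly_fun f 0 + (Y l)%:M) 0) = mpoly_fun f 0 + (Y l)%:M.
  have yO (j : 'I_1) : isO 1 (fun l => (mpoly_fun f 0 + (Y l)%:M) 0 j - mpoly_fun f 0 0 j).
    by apply: isO_ext (YM j); near=> l; rewrite [in RHS]mxE addrC addKr.
  by apply: filterS (isO1_near yO psi0) => l; apply.
have E := psi1E (fun l => (Y l)%:M) k isT YM.
have kuO := isOM (isOX K k) (uO i).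
have kYO := isO_scale_mul (A ord0) (isOM (isOX K k) YO).
(* The expansion of [psi] at [Y] is simplified by replacing [f (phi)] with its Taylor polynomial,
   [u] with [l ^+ k * v], the displaced coordinate with [l * x_i], and [Y] inside the [a1] term with
   [f (l x) - f (0)]. Each replacement costs at most order [k + 2]. *)
apply: isO_ext (isOB (isOB (isOB (isOB (isON E) (isO_le kk Tf)) vdfO)
  (isO_le kk kuO)) (isO_le kk kYO)); near=> l.
have -> : psi (row_mx (mpoly_fun f 0 + (Y l)%:M) (l ^+ k)%:M) =
  mpoly_fun f (l *: x) by near: l.
have -> : psi (row_mx (mpoly_fun f 0 + (Y l)%:M) 0) =
  mpoly_fun f 0 + (Y l)%:M by near: l.
rewrite f0E !mxE big_ord1 !mxE eqxx mulr1n (meval_eq _ (lxE l)).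
rewrite -(meval_eq _ (wE l)) -/(df l) /Y (wE l i) -/k.
rewrite -[\sum_j (b j + _) * _]/(\sum_j v l j * f^`M(j).@[fun m => l * x 0 m]).
by move: (\sum_j v l j * _) => s; ring.
Unshelve. all: by end_near. Qed.

(** By homogeneity the derivatives of [f] contribute at orders [d - 1] and [d] in [l], and the term
    in [a1] at order [d]. The retained identity is the coefficient of [l]; terms of order 2 or more
    go into the error. For [d = 0] the derivatives and [f - f (0)] vanish. *)
Lemma rl_stable_linear_part (K : numFieldType) n N d (h f : {mpoly K[n]}) i :
  h \is N.-homog -> f \is d.-homog ->
  rl_stable (fiber h 0) 0 (mpoly_fun f) ->
  exists (b : 'I_n -> K) (L : 'I_n -> 'I_n -> K) (a : K),
  forall x : 'I_n -> K, h.@[x] = 0 ->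
  [/\ \sum_j b j * h^`M(j).@[x] = 0,
      \sum_j (\sum_m L j m * x m) * h^`M(j).@[x] = 0
    & match d with
      | 1 => \sum_j (\sum_m L j m * x m) * f^`M(j).@[x] + x i + a * f.@[x]
      | 2 => \sum_j b j * f^`M(j).@[x] + x i
      | _ => x i
      end = 0].
Proof.
move=> hh hf /(rl_stable_first_order i hh) [b [L [a0 [a1 [k H]]]]].
exists b, L, a1 => x hx.
have xE : (\row_m x m) 0 =1 x by move=> m; rewrite mxE.
have [] := H (\row_m x m); first by rewrite (meval_eq _ xE).
have LE j : \sum_m L j m * (\row_m x m) 0 m = \sum_m L j m * x m.
  by apply: eq_bigr => m _; rewrite mxE.
rewrite (eq_bigr (fun j => b j * h^`M(j).@[x])) => [->|j _]; last first.
  by rewrite (meval_eq _ xE).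
rewrite (eq_bigr (fun j => (\sum_m L j m * x m) * h^`M(j).@[x])) => [->|j _]; last first.
  by rewrite LE (meval_eq _ xE).
move=> E; split=> //; rewrite addn2 in E.
have {E} : isO k.+2 (fun l => l ^+ k *
   (\sum_j (b j + l * (\sum_m L j m * x m)) * (l ^+ d.-1 * f^`M(j).@[x])
    + l * x i + (a0 + a1 * (l ^+ d * f.@[x] - 0 ^+ d * f.@[x])))).
  apply: isO_ext E; near=> l.
  have lE : (fun m => l * (\row_m x m) 0 m) =1 (fun m => l * x m).
    by move=> m; rewrite mxE.
  (* The factor [0 ^+ d] treats all degrees at once: it is 1 for [d = 0] and 0 otherwise. *)
  have f0 : f.@[fun=> 0] = 0 ^+ d * f.@[x].
    rewrite -(dhomog_meval_scale _ _ hf); apply: meval_eq => m.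
    by rewrite mul0r.
  rewrite mxE (meval_eq _ lE) (dhomog_meval_scale _ _ hf) f0.
  congr (_ * (_ + _ + _)); apply: eq_bigr => j _.
  by rewrite LE (meval_eq _ lE) (dhomog_meval_scale _ _ (dhomog_mderiv j hf)).
pose B := \sum_j b j * f^`M(j).@[x].
pose S := \sum_j (\sum_m L j m * x m) * f^`M(j).@[x].
have BS l : \sum_j (b j + l * (\sum_m L j m * x m)) * (l ^+ d.-1 * f^`M(j).@[x])
    = l ^+ d.-1 * B + l * l ^+ d.-1 * S.
  rewrite !mulr_sumr -big_split; apply: eq_bigr => j _ /=.
  by rewrite mulrDl; congr (_ + _); ring.
move=> E.
have {E} : isO k.+2 (fun l => l ^+ k * (l ^+ d.-1 * B + l * l ^+ d.-1 * S
    + l * x i + (a0 + a1 * (l ^+ d * f.@[x] - 0 ^+ d * f.@[x])))).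
  by apply: isO_ext E; near=> l; rewrite BS.
have k2O (u : K -> K) : isO 0 u -> isO k.+2 (fun l => l ^+ k.+2 * u l).
  by move=> uO; rewrite -[X in isO X]addn0; apply: isOM (isOX _ _) uO.
have lO m (c : K) : isO 0 (fun l => l ^+ m * c).
  by apply: isO_scale_mul; apply: isO_le (isOX _ _).
case: d hf @B @S BS => [|[|[|d]]] hf B S BS E.
- have F0 j : f^`M(j).@[x] = 0 by rewrite dhomog0_mderiv // meval0.
  have B0 : B = 0 by apply: big1 => j _; rewrite F0 mulr0.
  have S0 : S = 0 by apply: big1 => j _; rewrite F0 mulr0.
  suff: a0 = 0 /\ x i = 0 by case.
  by apply: (@isO_affine_eq0 _ k); apply: isO_ext E; near=> l; rewrite B0 S0; ring.
- suff: (B + a0) = 0 /\ S + x i + a1 * f.@[x] = 0 by case.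
  by apply: (@isO_affine_eq0 _ k); apply: isO_ext E; near=> l; rewrite /=; ring.
- suff: a0 = 0 /\ B + x i = 0 by case.
  apply: (@isO_affine_eq0 _ k).
  apply: isO_ext (isOB E (k2O _ (isO_cst (S + a1 * f.@[x])))); near=> l.
  by rewrite /= !exprS; ring.
- suff: a0 = 0 /\ x i = 0 by case.
  apply: (@isO_affine_eq0 _ k).
  apply: isO_ext (isOB E (k2O _ (isOD (lO d B) (lO d.+1 (S + a1 * f.@[x]))))).
  by near=> l; rewrite /= !exprS; ring.
Unshelve. all: by end_near. Qed.

(** * Critical points on the fibres *)

Lemma near_neq (K : numFieldType) n (x y : 'rV[K]_n) :
  x != y -> \forall z \near x, z <> y.
Proof.
move=> xy; have [i xyi] : exists i, x 0 i != y 0 i.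
  apply: contrapT => /forallNP E; case/negP: xy; apply/eqP/rowP => i.
  by apply/eqP/negbNE/negP/E.
apply/nbhs_ballP; exists `|x 0 i - y 0 i| => /=.
  by rewrite normr_gt0 subr_eq0.
move=> z [_ /(_ 0 i)]; rewrite -ball_normE /= => xz zy.
by rewrite zy ltxx in xz.
Qed.

(** [A] lies in the finite set of multiples of [x] by [N]-th roots of unity, and a neighbourhood of
    [x] avoids those multiples that differ from [x]. *)
Lemma isolated_unity_multiples (K : numClosedFieldType) n N (A : set 'rV[K]_n) x :
  (0 < N)%N -> A x ->
  (forall y, A y -> exists2 mu : K, mu ^+ N = 1 & y = mu *: x) ->
  isolated A x.
Proof.
move=> N0 Ax AN; split; first exact/mem_set.
have [rs rsE] := closed_field_poly_normal ('X^N - 1 : {poly K}).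
have V : \forall y \near x, forall mu, mu \in rs -> mu *: x != x -> y <> mu *: x.
  elim: (rs) => [|mu s IH]; first by near=> y.
  have Vmu : \forall y \near x, mu *: x != x -> y <> mu *: x.
    have [E|] := boolP (mu *: x == x); first by near=> y.
    rewrite eq_sym => /near_neq H.
    by apply: filterS H => y.
  apply: filterS2 Vmu IH => y ymu ys nu; rewrite inE => /orP[/eqP -> //|].
  exact: ys.
exists [set y | forall mu, mu \in rs -> mu *: x != x -> y <> mu *: x] => //.
apply/seteqP; split=> [y [Vy /AN [mu muN yE]]|y -> ]; last first.
  by split=> // mu _ /eqP mux xE; apply: mux.
have [E|/(Vy mu)] := eqVneq (mu *: x) x; first by rewrite yE E.
case=> //; have : root ('X^N - 1) mu.
  by rewrite rootE !hornerE muN subrr.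
have lc : lead_coef ('X^N - 1 : {poly K}) != 0.
  by rewrite lead_coef_eq0 -size_poly_eq0 size_XnsubC.
by rewrite rsE rootZ // root_prod_XsubC.
Unshelve. all: by end_near. Qed.

Lemma meval_homog_at0 (K : numFieldType) n d (p : {mpoly K[n]}) (x : 'I_n -> K) :
  (0 < d)%N -> p \is d.-homog -> (forall i, x i = 0) -> p.@[x] = 0.
Proof.
move=> d0 hp x0; have E : x =1 (fun i => 0 * x i) by move=> i; rewrite mul0r x0.
by rewrite (meval_eq _ E) (dhomog_meval_scale _ _ hp) expr0n eqn0Ngt d0 mul0r.
Qed.

(** In at most one variable the fibre has at most one point and its tangent space is zero, so all
    three conditions are immediate. *)
Lemma morse_subsingleton (K : numClosedFieldType) n (h f : {mpoly K[n]}) (t : K) :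
  (n <= 1)%N -> h \is n.-homog -> t != 0 -> morse f h t.
Proof.
move=> n1 hh t0.
have fib x y : fiber h t x -> fiber h t y -> x = y.
  move=> hx hy; case: n n1 h f hh x y hx hy => [|[|//]] _ h f hh x y hx hy.
    by apply/rowP; case.
  have x0 : x 0 0 != 0.
    apply: contraNneq t0 => x0; rewrite -hx.
    by rewrite (meval_homog_at0 _ hh) // => i; rewrite ord1.
  have yE : y 0 =1 (fun i => y 0 0 / x 0 0 * x 0 i).
    by move=> i; rewrite ord1 divfK.
  move: hy; rewrite /fiber /= (meval_eq _ yE) (dhomog_meval_scale _ _ hh) hx expr1.
  rewrite -[RHS]mul1r => /(mulIf t0) E.
  by apply/rowP => i; rewrite yE E mul1r.
split=> [x cx|x [hx _] v hv v0|x y [hx _] [hy _] _]; last exact: fib.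
  apply: (@isolated_unity_multiples _ _ 1) => // y [hy _].
  by exists 1; rewrite ?expr1n // scale1r; apply: fib => //; case: cx.
exfalso; case/eqP: v0; apply/rowP => i; rewrite [RHS]mxE.
case: n n1 h f hh {fib} x v hx hv i => [|[|//]] _ h f hh x v hx hv i; first by case: i.
(* Euler's relation gives [x_0 h'(x) = t], so [h'(x)] is nonzero and a tangent vector must
   vanish. *)
have := euler (x 0) hh; rewrite hx big_ord1 mul1r (ord1 i) => E.
move: hv; rewrite /tangent /= /dmpoly big_ord1 => /eqP; rewrite mulf_eq0.
by case/orP => /eqP // H; rewrite H mulr0 in E; rewrite -E eqxx in t0.
Qed.

(** The fields [W i] are tangent to every fibre, so a critical point is determined by its value of
    [f], which is nonzero since otherwise [x = 0] and [h (x) = 0]. Two critical points are then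
    proportional, and comparing the values of [h] makes the ratio an [n]-th root of unity, whence
    isolation. *)
Lemma morse_of_fields (K : numClosedFieldType) n (h f : {mpoly K[n]}) (t : K)
    (W : 'I_n -> 'I_n -> {mpoly K[n]}) (c : 'I_n -> K) :
  (0 < n)%N -> h \is n.-homog -> t != 0 ->
  (forall i, lie (W i) h = 0) ->
  (forall i, lie (W i) f = - ('X_i + c i *: f)) ->
  morse f h t.
Proof.
move=> n0 hh t0 Wh Wf.
have lieE i p (x : 'rV[K]_n) : (lie (W i) p).@[x 0] = dmpoly p x (\row_j (W i j).@[x 0]).
  by rewrite raddf_sum; apply: eq_bigr => j _; rewrite mxE /= mevalM.
have Wtan i : tangent_field h t (W i).
  by move=> x hx; rewrite /tangent /= -lieE Wh meval0.
have critE (x : 'rV[K]_n) i : critical f h t x -> x 0 i = - c i * f.@[x 0].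
  move=> [hx /(_ _ (Wtan i x hx))]; rewrite -lieE Wf mevalN mevalD mevalXU mevalZ.
  by move/eqP; rewrite oppr_eq0 addr_eq0 mulNr => /eqP.
have f0 (x : 'rV[K]_n) : critical f h t x -> f.@[x 0] != 0.
  move=> cx; apply: contraNneq t0 => fx0; have [<- _] := cx.
  by rewrite (meval_homog_at0 n0 hh) // => i; rewrite critE // fx0 mulr0.
split=> [x cx|x cx v vT v0|x y cx cy fxy]; last first.
- by apply/rowP => i; rewrite !critE // fxy.
- have [i vi] : exists i, v 0 i != 0.
    apply: contrapT => /forallNP E; case/negP: v0; apply/eqP/rowP => i.
    by rewrite mxE; apply/eqP/negbNE/negP/E.
  exists (W i); split=> //.
  have -> : dmpoly (lie (W i) f) x v = - (v 0 i + c i * dmpoly f x v).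
    rewrite Wf /dmpoly mulr_sumr -[v 0 i]mulr1.
    rewrite (eq_bigr (fun j => - (v 0 j * (i == j)%:R + c i * (v 0 j * f^`M(j).@[x 0])))).
      rewrite sumrN big_split (bigD1 i) //= eqxx big1 ?addr0 //.
      by move=> j ji; rewrite eq_sym (negbTE ji) mulr0.
    move=> j _; rewrite mderivN mderivD mderivZ mevalN mevalD mevalZ mderivX mnm1E.
    rewrite mulrN mulrDr [v 0 j * (c i * _)]mulrCA; congr (- (_ * _ + _)).
    rewrite eq_sym; case: eqP => [->|_]; last by rewrite scale0r meval0.
    by rewrite -{1}[U_(i)%MM]add0m addmK mpolyX0 scale1r meval1.
  (* Criticality of [x] removes the term [c i * dmpoly f x v], leaving [- v 0 i]. *)
  by have [_ ->] := cx; rewrite // mulr0 addr0 oppr_eq0.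
- apply: (isolated_unity_multiples n0) => // y cy.
  have yE : y = (f.@[y 0] / f.@[x 0]) *: x.
    apply/rowP => i; rewrite mxE !critE // mulrCA divfK //.
    exact: f0.
  exists (f.@[y 0] / f.@[x 0]) => //.
  have [[hx _] [hy _]] := (cx, cy); apply: (mulIf t0).
  rewrite mul1r -{1}hx -(dhomog_meval_scale _ _ hh) -[RHS]hy [in RHS]yE.
  by apply: meval_eq => i; rewrite mxE.
Qed.

(** * Case distinction on the degree of [f] *)

Lemma stable_morse (K : numClosedFieldType) n d (h f : {mpoly K[n]}) (t : K) :
  h != 0 -> h \is n.-homog -> reduced h -> f \is d.-homog ->
  rl_stable (fiber h 0) 0 (mpoly_fun f) -> t != 0 ->
  morse f h t \/ critical f h t = set0.
Proof.
move=> h0 hh hred hf fst t0; case: (leqP n 1) => [n1|n1].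
  by left; exact: morse_subsingleton.
have n0 : (0 < n)%N by exact: ltnW.
have hX (i : 'I_n) : ('X_i : {mpoly K[n]}) \is 1.-homog by rewrite dhomogX /= mdeg1.
(* A coordinate has degree less than [n] exactly because [n >= 2], so it cannot vanish on the zero
   set of [h]. *)
have X_nvan (i : 'I_n) : ~ forall x : 'I_n -> K, h.@[x] = 0 -> x i = 0.
  move=> xi; have : ('X_i : {mpoly K[n]}) = 0.
    apply: (vanishing_lt_eq0 h0 hh hred (hX i) n1) => x /xi.
    by rewrite mevalXU.
  move/(congr1 (meval (fun=> 1))); rewrite mevalXU meval0 => /eqP.
  by rewrite oner_eq0.
have i0 : 'I_n := Ordinal n0.
have /choice [b /choice [L /choice [a H]]] :=
  fun i => rl_stable_linear_part i hh hf fst.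
case: d hf H => [|[|[|d]]] hf H.
- by case: (X_nvan i0) => x /(H i0) [].
- left; pose F i j := \sum_m L i j m *: 'X_m : {mpoly K[n]}.
  have FE i j x : (F i j).@[x] = \sum_m L i j m * x m.
    by rewrite raddf_sum; apply: eq_bigr => m _; rewrite /= mevalZ mevalXU.
  have Fhom i j : F i j \is 1.-homog by apply: rpred_sum => m _; exact: rpredZ.
  have lieF i p x : (lie (F i) p).@[x] =
      \sum_j (\sum_m L i j m * x m) * p^`M(j).@[x].
    by rewrite raddf_sum; apply: eq_bigr => j _; rewrite /= mevalM FE.
  have lieF_homog i p m : (0 < m)%N -> p \is m.-homog ->
      lie (F i) p \is m.-homog.
    case: m => // m _ hp; apply: rpred_sum => j _; rewrite -add1n; apply: dhomogM => //.
    exact: (dhomog_mderiv j hp).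
  have /choice [c Fh] : forall i, exists c, lie (F i) h = c *: h.
    move=> i; apply: (vanishing_proportional h0 hh hred).
      exact: lieF_homog.
    by move=> x hx; rewrite lieF; have [] := H i x hx.
  have Ff i : lie (F i) f = - ('X_i + a i *: f).
    apply/eqP; rewrite -subr_eq0 opprK addrA; apply/eqP.
    apply: (vanishing_lt_eq0 h0 hh hred _ n1).
      by rewrite !rpredD ?rpredZ //; exact: lieF_homog.
    move=> x hx; rewrite !mevalD mevalZ mevalXU lieF.
    by have [] := H i x hx.
  (* The Euler field multiplies [h] by [n], so subtracting [c i / n] times it kills [c i *: h]. On
     [f], of degree 1, this subtracts [(c i / n%:R) *: f], which only changes the constant passed to
     [morse_of_fields]. *)
  pose W i j := F i j - (c i / n%:R) *: 'X_j.
  have lieW i p m : p \is m.-homog ->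
      lie (W i) p = lie (F i) p - (c i / n%:R * m%:R) *: p.
    move=> hp; apply/eqP; rewrite -subr_eq0; apply/eqP.
    apply: mpoly_meval_eq0 => x; apply/eqP.
    rewrite mevalB subr_eq0 mevalB mevalZ -[_ * p.@[_]]mulrA -(euler _ hp) !raddf_sum.
    rewrite mulr_sumr -sumrB; apply/eqP/eq_bigr => j _ /=.
    by rewrite !mevalM mevalB mevalZ mevalXU mulrBl mulrA.
  have nn0 : n%:R != 0 :> K by rewrite pnatr_eq0 -lt0n.
  apply: (morse_of_fields (W := W) (c := fun i => a i + c i / n%:R)) => // i.
    by rewrite (lieW _ _ _ hh) Fh divfK // subrr.
  by rewrite (lieW _ _ _ hf) Ff mulr1 scalerDl addrA [RHS]opprD.
- right; apply/seteqP; split=> // x [hx cx].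
  have hb i : \sum_j b i j *: h^`M(j) = 0.
    apply: (@vanishing_lt_eq0 _ _ n.-1 _ _ _ h0 hh hred).
    + by apply: rpred_sum => j _; apply: rpredZ; exact: dhomog_mderiv.
    + by rewrite prednK.
    + move=> y hy; have [<- _ _] := H i y hy; rewrite raddf_sum.
      by apply: eq_bigr => j _; rewrite /= mevalZ.
  have fb i : \sum_j b i j *: f^`M(j) + 'X_i = 0.
    apply: (vanishing_lt_eq0 h0 hh hred _ n1).
      apply: rpredD => //; apply: rpred_sum => j _; apply: rpredZ.
      exact: (dhomog_mderiv j hf).
    move=> y hy; have [_ _ <-] := H i y hy; rewrite mevalD mevalXU raddf_sum.
    by congr (_ + _); apply: eq_bigr => j _; rewrite /= mevalZ.
  have dE i p : dmpoly p x (\row_j b i j) = (\sum_j b i j *: p^`M(j)).@[x 0].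
    by rewrite raddf_sum; apply: eq_bigr => j _; rewrite /= mevalZ mxE.
  case/eqP: t0; rewrite -hx (meval_homog_at0 n0 hh) // => i.
  have := congr1 (meval (x 0)) (fb i); rewrite mevalD mevalXU meval0 -dE cx ?add0r //.
  by rewrite /tangent /= dE hb meval0.
- by case: (X_nvan i0) => x /(H i0) [].
Qed.

Local Open Scope complex_scope.

Theorem proposition3p2 (R : realType) (n d : nat) (h f : {mpoly R[i][n]})
    (h_neq0 : h != 0) (h_homog : h \is n.-homog) (h_reduced : reduced h)
    (f_homog : f \is d.-homog)
    (f_stable : rl_stable (fiber h 0) 0 (mpoly_fun f))
    (t : R[i]) (t_neq0 : t != 0) :
  morse f h t \/ critical f h t = set0.
Proof. exact: (stable_morse h_neq0 h_homog h_reduced f_homog f_stable t_neq0). Qed.
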